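(* For $x\in\mathbb{C}^3$ the following are equivalent: (1) $x\in K_0$; (2) $x$ is a peak point of $\overline{\mathcal{P}}$; (3) $x$ belongs to the distinguished boundary $b\mathcal{P}$ of $\mathcal{P}$. Consequently $$b\mathcal{P}=\{(a,s,p)\in\mathbb{C}^3:(s,p)\in b\Gamma,\ |a|=\sqrt{1-\tfrac14|s|^2}\}=\{(a,s,p)\in\mathbb{C}^3: |s|\le2,\ |p|=1,\ s=\bar sp,\ |a|=\sqrt{1-\tfrac14|s|^2}\}.$$
   Context: $\mathbb{T}$ is the unit circle, $b\Gamma=\{(z_1+z_2,z_1z_2):z_1,z_2\in\mathbb{T}\}$, and $K_0=\{(a,s,p):(s,p)\in b\Gamma,\ |a|=\sqrt{1-\tfrac14|s|^2}\}$. $\mathbb{B}$ is the open unit ball of $\mathbb{C}^{2\times2}$ (operator norm), $\pi(A)=(a_{21},\operatorname{tr}A,\det A)$, $\mathcal{P}=\pi(\mathbb{B})$, $\overline{\mathcal{P}}$ its closure. $A(\mathcal{P})$ is the algebra of continuous functions on $\overline{\mathcal{P}}$ holomorphic on $\mathcal{P}$. A closed boundary is a closed subset $C\subset\overline{\mathcal{P}}$ on which every $f\in A(\mathcal{P})$ attains its maximum modulus; the distinguished (Shilov) boundary $b\mathcal{P}$ is the smallest closed boundary (which exists since $\overline{\mathcal{P}}$ is polynomially convex). A point $u\in\overline{\mathcal{P}}$ is a peak point if there is $g\in A(\mathcal{P})$ with $g(u)=1$ and $|g(x)|<1$ for all $x\in\overline{\mathcal{P}}\setminus\{u\}$. *)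

(* Defs.v *)
From Stdlib Require Import Reals.
Open Scope R_scope.

Definition C := (R * R)%type.
Definition Cre (z : C) : R := fst z.
Definition Cim (z : C) : R := snd z.
Definition Cadd (z w : C) : C := (fst z + fst w, snd z + snd w).
Definition Csub (z w : C) : C := (fst z - fst w, snd z - snd w).
Definition Cmul (z w : C) : C :=
  (fst z * fst w - snd z * snd w, fst z * snd w + snd z * fst w).
Definition Cconj (z : C) : C := (fst z, - snd z).
Definition Cmod2 (z : C) : R := fst z * fst z + snd z * snd z.
Definition Cmod (z : C) : R := sqrt (Cmod2 z).
Definition C0 : C := (0, 0).

Definition C3 := (C * C * C)%type.
Definition C3norm (x : C3) : R :=
  let '(a, s, p) := x in sqrt (Cmod2 a + Cmod2 s + Cmod2 p).
Definition C3sub (x y : C3) : C3 :=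
  let '(a, s, p) := x in let '(a', s', p') := y in
  (Csub a a', Csub s s', Csub p p').
Definition C3dist (x y : C3) : R := C3norm (C3sub x y).

Record M2 := mkM2 { m11 : C; m12 : C; m21 : C; m22 : C }.

Definition C2norm2 (v : C * C) : R := Cmod2 (fst v) + Cmod2 (snd v).
Definition M2app (A : M2) (v : C * C) : C * C :=
  (Cadd (Cmul (m11 A) (fst v)) (Cmul (m12 A) (snd v)),
   Cadd (Cmul (m21 A) (fst v)) (Cmul (m22 A) (snd v))).

(** A lies in the open unit ball B of C^{2x2} for the operator norm:
    ||A|| < 1, i.e. there is r < 1 with |Av| <= r |v| for all v. *)
Definition in_unit_ball (A : M2) : Prop :=
  exists r : R, 0 <= r /\ r < 1 /\
    forall v : C * C, C2norm2 (M2app A v) <= r * r * C2norm2 v.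

Definition Ctr (A : M2) : C := Cadd (m11 A) (m22 A).
Definition Cdet (A : M2) : C := Csub (Cmul (m11 A) (m22 A)) (Cmul (m12 A) (m21 A)).

Definition piM (A : M2) : C3 := (m21 A, Ctr A, Cdet A).

Definition inP (x : C3) : Prop := exists A : M2, in_unit_ball A /\ piM A = x.
Definition inPbar (x : C3) : Prop :=
  forall eps : R, 0 < eps -> exists y : C3, inP y /\ C3dist x y < eps.

Definition continuous_on_Pbar (f : C3 -> C) : Prop :=
  forall x : C3, inPbar x -> forall eps : R, 0 < eps ->
    exists delta : R, 0 < delta /\
      forall y : C3, inPbar y -> C3dist y x < delta -> Cmod (Csub (f y) (f x)) < eps.

Definition C_differentiable_at (f : C3 -> C) (x : C3) : Prop :=
  exists c1 c2 c3 : C,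
    forall eps : R, 0 < eps -> exists delta : R, 0 < delta /\
      forall y : C3, inP y -> C3dist y x < delta ->
        let '(a, s, p) := y in let '(a0, s0, p0) := x in
        Cmod (Csub (Csub (f y) (f x))
                   (Cadd (Cmul c1 (Csub a a0))
                         (Cadd (Cmul c2 (Csub s s0)) (Cmul c3 (Csub p p0)))))
          <= eps * C3dist y x.

Definition holomorphic_on_P (f : C3 -> C) : Prop :=
  forall x : C3, inP x -> C_differentiable_at f x.

Definition in_AP (f : C3 -> C) : Prop := continuous_on_Pbar f /\ holomorphic_on_P f.

Definition closed_set (S : C3 -> Prop) : Prop :=
  forall x : C3, (forall eps : R, 0 < eps -> exists y, S y /\ C3dist x y < eps) -> S x.

Definition closed_boundary (S : C3 -> Prop) : Prop :=
  closed_set S /\ (forall x, S x -> inPbar x) /\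
  forall f : C3 -> C, in_AP f ->
    exists c : C3, S c /\ forall y : C3, inPbar y -> Cmod (f y) <= Cmod (f c).

Definition is_distinguished_boundary (S : C3 -> Prop) : Prop :=
  closed_boundary S /\
  forall S' : C3 -> Prop, closed_boundary S' -> forall x, S x -> S' x.

Definition peak_point (u : C3) : Prop :=
  inPbar u /\
  exists g : C3 -> C, in_AP g /\ g u = (1, 0) /\
    forall x : C3, inPbar x -> x <> u -> Cmod (g x) < 1.

Definition in_bGamma (s p : C) : Prop :=
  exists z1 z2 : C, Cmod z1 = 1 /\ Cmod z2 = 1 /\ s = Cadd z1 z2 /\ p = Cmul z1 z2.

Definition inK0 (x : C3) : Prop :=
  let '(a, s, p) := x in
  in_bGamma s p /\ Cmod a = sqrt (1 - / 4 * (Cmod s * Cmod s)).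

Definition inK0' (x : C3) : Prop :=
  let '(a, s, p) := x in
  Cmod s <= 2 /\ Cmod p = 1 /\ s = Cmul (Cconj s) p /\
  Cmod a = sqrt (1 - / 4 * (Cmod s * Cmod s)).

(* Main.v *)
(** Points of K_0 are peak points through the affine function
    (1 + conj a0 a + conj s0 s / 4 + conj p0 p) / 3, because |a|^2 + |s|^2 / 4 <= 1 and |p| <= 1
    on the closure of P; and peak points lie in every closed boundary.  It remains to see that K_0
    itself is a closed boundary.  By the singular value decomposition a contraction A is
    z1 u v^* + z2 u' v'^*, and pi(A) is affine in z1 and in z2, so the maximum principle moves
    |z1| and |z2| to a common r < 1, i.e. A to r times a unitary matrix.  For the unitary matrix
    (s, p) lies in b Gamma and |a|^2 <= 1 - |s|^2 / 4, so a further disc in the variable a leads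
    to points close to K_0; compactness of K_0 then gives the maximum. *)

Require Import Defs.
From Stdlib Require Import Reals Lra Psatz Classical IndefiniteDescription.
From Coquelicot Require Import Coquelicot.
Open Scope R_scope.

(** Membership in [in_AP] gives only pointwise complex differentiability inside P, with no
    continuity of the derivative, so Green's formula does not apply. The one-variable maximum
    principle is therefore built from Goursat's bisection. Applied to a rectangle in the coordinate
    log z, it equates the means over two concentric circles. This yields the mean value bound at the
    centre, and Moebius maps carry the centre to any other point. On the boundary of P only
    continuity is known, so every disc has to stay inside P. The argument reaches points within 3 (1
    - r^2) of K_0, never K_0 itself. Hence the bound is first proved with a neighbourhood of K_0 in
    place of K_0, and the passage to K_0 is a separate argument by contradiction. That argument
    takes the supremum of |f| / (1 + |f|), which exists without knowing beforehand that f is bounded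
    on the closure. *)

(** * Goursat's theorem for rectangles *)

Definition CR_at (u v : R -> R -> R) (x0 y0 : R) : Prop :=
  exists al be : R, forall eps, 0 < eps -> exists del, 0 < del /\
    forall x y, Rabs (x - x0) < del -> Rabs (y - y0) < del ->
      Rabs (u x y - u x0 y0 - (al * (x - x0) - be * (y - y0)))
        <= eps * (Rabs (x - x0) + Rabs (y - y0)) /\
      Rabs (v x y - v x0 y0 - (be * (x - x0) + al * (y - y0)))
        <= eps * (Rabs (x - x0) + Rabs (y - y0)).

(* The imaginary part of the integral of u + iv around [a,b] x [c,d]. *)
Definition flux (u v : R -> R -> R) (a b c d : R) : R :=
  RInt (fun y => u b y - u a y) c d + RInt (fun x => v x c - v x d) a b.

Lemma continuous_eps (f : R -> R) (x0 : R) :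
  (forall eps, 0 < eps -> exists del, 0 < del /\
     forall x, Rabs (x - x0) < del -> Rabs (f x - f x0) < eps) ->
  continuous f x0.
Proof.
  intros H. apply continuity_pt_filterlim. intros eps Heps.
  destruct (H eps Heps) as [del [Hdel Hf]].
  exists del; split; [exact Hdel|].
  intros x [_ Hx]. exact (Hf x Hx).
Qed.

Lemma small_linear_error (e l1 l2 h : R) :
  0 < e -> Rabs h < e / (Rabs l1 + Rabs l2 + 2) ->
  (Rabs l1 + Rabs l2 + 1) * Rabs h < e.
Proof.
  intros He Hh.
  pose proof (Rabs_pos l1). pose proof (Rabs_pos l2). pose proof (Rabs_pos h).
  assert (Rabs h * (Rabs l1 + Rabs l2 + 2) < e).
  { replace e with (e / (Rabs l1 + Rabs l2 + 2) * (Rabs l1 + Rabs l2 + 2)) by (field; lra).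
    apply Rmult_lt_compat_r; lra. }
  nra.
Qed.

(** This is the continuity that makes the integrands of [flux] integrable: vertical sides involve
    only [u], horizontal sides only [v]. *)
Lemma CR_at_lines (u v : R -> R -> R) (x0 y0 : R) : CR_at u v x0 y0 ->
  continuous (fun y => u x0 y) y0 /\ continuous (fun x => v x y0) x0.
Proof.
  intros [al [be H]]. destruct (H 1 Rlt_0_1) as [del [Hdel H1]].
  split; apply continuous_eps; intros eps Heps;
    exists (Rmin del (eps / (Rabs al + Rabs be + 2)));
    (split; [apply Rmin_pos; [exact Hdel|]; apply Rdiv_lt_0_compat; [exact Heps|];
       pose proof (Rabs_pos al); pose proof (Rabs_pos be); lra|]);
    intros t Ht;
    assert (Ht1 : Rabs (t - x0) < del \/ Rabs (t - y0) < del)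
      by (first [left; exact (Rlt_le_trans _ _ _ Ht (Rmin_l _ _))
               | right; exact (Rlt_le_trans _ _ _ Ht (Rmin_l _ _))]);
    pose proof (small_linear_error _ _ _ _ Heps (Rlt_le_trans _ _ _ Ht (Rmin_r _ _))) as Hs.
  - destruct (H1 x0 t) as [Hu _].
    { replace (x0 - x0) with 0 by ring; rewrite Rabs_R0; exact Hdel. }
    { exact (Rlt_le_trans _ _ _ Ht (Rmin_l _ _)). }
    replace (x0 - x0) with 0 in Hu by ring. rewrite Rabs_R0 in Hu.
    replace (u x0 t - u x0 y0) with
      ((u x0 t - u x0 y0 - (al * 0 - be * (t - y0))) + (- (be * (t - y0)))) by ring.
    eapply Rle_lt_trans; [apply Rabs_triang|]. rewrite Rabs_Ropp, Rabs_mult.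
    pose proof (Rabs_pos al). pose proof (Rabs_pos (t - y0)). nra.
  - destruct (H1 t y0) as [_ Hv].
    { exact (Rlt_le_trans _ _ _ Ht (Rmin_l _ _)). }
    { replace (y0 - y0) with 0 by ring; rewrite Rabs_R0; exact Hdel. }
    replace (y0 - y0) with 0 in Hv by ring. rewrite Rabs_R0 in Hv.
    replace (v t y0 - v x0 y0) with
      ((v t y0 - v x0 y0 - (be * (t - x0) + al * 0)) + (be * (t - x0))) by ring.
    eapply Rle_lt_trans; [apply Rabs_triang|]. rewrite Rabs_mult.
    pose proof (Rabs_pos al). pose proof (Rabs_pos (t - x0)). nra.
Qed.

Lemma nested_intervals (lo hi : nat -> R) :
  (forall n, lo n <= lo (S n)) -> (forall n, hi (S n) <= hi n) -> (forall n, lo n <= hi n) ->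
  exists z, forall n, lo n <= z <= hi n.
Proof.
  intros Hlo Hhi Hlh.
  assert (M1 : forall n m, (n <= m)%nat -> lo n <= lo m).
  { induction 1; [lra|]. specialize (Hlo m). lra. }
  assert (M2 : forall n m, (n <= m)%nat -> hi m <= hi n).
  { induction 1; [lra|]. specialize (Hhi m). lra. }
  assert (H : forall n m, lo n <= hi m).
  { intros n m. destruct (Nat.le_ge_cases n m) as [h | h].
    - apply Rle_trans with (lo m); auto.
    - apply Rle_trans with (hi n); auto. }
  destruct (completeness (fun x => exists n, x = lo n)) as [z [Hz1 Hz2]].
  - exists (hi 0%nat). intros x [n ->]. apply H.
  - exists (lo 0%nat), 0%nat. reflexivity.
  - exists z. intros n. split; [apply Hz1; now exists n|].
    apply Hz2. intros x [m ->]. apply H.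
Qed.

Section Goursat.
Variables (u v : R -> R -> R) (X : R).
(** A half-plane is enough: for [X = 0] its image under the exponential is the punctured unit
    disc. *)
Hypothesis HCR : forall x y, x < X -> CR_at u v x y.

Lemma ex_RInt_vert (a c d : R) : a < X -> ex_RInt (fun y => u a y) c d.
Proof.
  intros Ha. apply (ex_RInt_continuous (V := R_CompleteNormedModule)). intros y _.
  exact (proj1 (CR_at_lines u v a y (HCR a y Ha))).
Qed.

Lemma ex_RInt_horiz (a b c : R) : a <= b -> b < X -> ex_RInt (fun x => v x c) a b.
Proof.
  intros Hab Hb. apply (ex_RInt_continuous (V := R_CompleteNormedModule)). intros x [_ Hx].
  rewrite Rmax_right in Hx by exact Hab.
  apply (CR_at_lines u v x c). apply HCR. lra.
Qed.

Lemma ex_RInt_vert2 (a b c d : R) : a < X -> b < X ->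
  ex_RInt (fun y => u b y - u a y) c d.
Proof.
  intros Ha Hb. apply (ex_RInt_minus (V := R_NormedModule)); now apply ex_RInt_vert.
Qed.

Lemma ex_RInt_horiz2 (a b c d : R) : a <= b -> b < X ->
  ex_RInt (fun x => v x c - v x d) a b.
Proof.
  intros Ha Hb. apply (ex_RInt_minus (V := R_NormedModule)); now apply ex_RInt_horiz.
Qed.

Lemma flux_eq (a b c d : R) : a <= b -> b < X ->
  flux u v a b c d = RInt (fun y => u b y) c d - RInt (fun y => u a y) c d
     + (RInt (fun x => v x c) a b - RInt (fun x => v x d) a b).
Proof.
  intros Hab Hb. unfold flux. f_equal.
  - apply (RInt_minus (V := R_CompleteNormedModule)); apply ex_RInt_vert; lra.
  - apply (RInt_minus (V := R_CompleteNormedModule)); apply ex_RInt_horiz; lra.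
Qed.

Lemma flux_split (a m b c n d : R) : a <= m -> m <= b -> b < X ->
  flux u v a b c d = flux u v a m c n + flux u v a m n d
    + (flux u v m b c n + flux u v m b n d).
Proof.
  intros H1 H2 H3. rewrite !flux_eq by lra.
  assert (Hv : forall x, x < X ->
    RInt (fun y => u x y) c d = RInt (fun y => u x y) c n + RInt (fun y => u x y) n d).
  { intros x Hx. symmetry.
    apply (RInt_Chasles (V := R_CompleteNormedModule)); now apply ex_RInt_vert. }
  assert (Hh : forall y,
    RInt (fun x => v x y) a b = RInt (fun x => v x y) a m + RInt (fun x => v x y) m b).
  { intros y. symmetry.
    apply (RInt_Chasles (V := R_CompleteNormedModule)); apply ex_RInt_horiz; lra. }
  rewrite !Hv, !Hh by lra. ring.
Qed.

(* The affine part of u + iv contributes nothing, so only the error terms count. *)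
Lemma flux_small (x0 y0 eps : R) : x0 < X -> 0 < eps ->
  exists del, 0 < del /\ forall a b c d,
    a <= x0 <= b -> c <= y0 <= d -> b < X -> b - a < del -> d - c < del ->
    Rabs (flux u v a b c d) <= eps * ((b - a) + (d - c)) * ((b - a) + (d - c)).
Proof.
  intros Hx0 Heps. destruct (HCR x0 y0 Hx0) as [al [be H]].
  (* Halved because each integrand of [flux] is a difference of two values, each with its own
     error. *)
  destruct (H (eps / 2)) as [del [Hdel HH]]; [lra|].
  exists del; split; [exact Hdel|].
  intros a b c d Hx Hy HbX Hab Hcd.
  set (L := (b - a) + (d - c)).
  assert (E : forall x y, a <= x <= b -> c <= y <= d ->
     Rabs (u x y - u x0 y0 - (al * (x - x0) - be * (y - y0))) <= eps / 2 * L /\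
     Rabs (v x y - v x0 y0 - (be * (x - x0) + al * (y - y0))) <= eps / 2 * L).
  { intros x y Hxx Hyy.
    assert (A1 : Rabs (x - x0) <= b - a) by (apply Rabs_le; lra).
    assert (A2 : Rabs (y - y0) <= d - c) by (apply Rabs_le; lra).
    destruct (HH x y) as [B1 B2]; [lra|lra|].
    assert (eps / 2 * (Rabs (x - x0) + Rabs (y - y0)) <= eps / 2 * L)
      by (apply Rmult_le_compat_l; unfold L; lra).
    lra. }
  (* Between opposite sides the [be] terms cancel, so the affine parts of the two integrands are the
     constants al (b - a) and - al (d - c). Their integrals are opposite numbers. *)
  assert (V1 : Rabs (RInt (fun y => (u b y - u a y) - al * (b - a)) c d) <= (d - c) * (eps * L)).
  { apply abs_RInt_le_const; [lra| |].
    - apply (ex_RInt_minus (V := R_NormedModule)).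
      + apply ex_RInt_vert2; lra.
      + apply ex_RInt_const.
    - intros y Hyy. destruct (E b y) as [B1 _]; [lra|lra|].
      destruct (E a y) as [B2 _]; [lra|lra|].
      apply Rabs_le_between in B1. apply Rabs_le_between in B2.
      apply Rabs_le. split; lra. }
  assert (V2 : Rabs (RInt (fun x => (v x c - v x d) - (- al * (d - c))) a b) <= (b - a) * (eps * L)).
  { apply abs_RInt_le_const; [lra| |].
    - apply (ex_RInt_minus (V := R_NormedModule)).
      + apply ex_RInt_horiz2; lra.
      + apply ex_RInt_const.
    - intros x Hxx. destruct (E x c) as [_ B1]; [lra|lra|].
      destruct (E x d) as [_ B2]; [lra|lra|].
      apply Rabs_le_between in B1. apply Rabs_le_between in B2.
      apply Rabs_le. split; lra. }
  assert (W1 : RInt (fun y => (u b y - u a y) - al * (b - a)) c d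
     = RInt (fun y => u b y - u a y) c d - (d - c) * (al * (b - a))).
  { rewrite (RInt_minus (V := R_CompleteNormedModule) (fun y => u b y - u a y) (fun _ => al * (b - a))).
    - rewrite (RInt_const (V := R_CompleteNormedModule)). reflexivity.
    - apply ex_RInt_vert2; lra.
    - apply ex_RInt_const. }
  assert (W2 : RInt (fun x => (v x c - v x d) - (- al * (d - c))) a b
     = RInt (fun x => v x c - v x d) a b - (b - a) * (- al * (d - c))).
  { rewrite (RInt_minus (V := R_CompleteNormedModule) (fun x => v x c - v x d) (fun _ => - al * (d - c))).
    - rewrite (RInt_const (V := R_CompleteNormedModule)). reflexivity.
    - apply ex_RInt_horiz2; lra.
    - apply ex_RInt_const. }
  replace (flux u v a b c d) with
    (RInt (fun y => (u b y - u a y) - al * (b - a)) c d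
     + RInt (fun x => (v x c - v x d) - (- al * (d - c))) a b)
    by (rewrite W1, W2; unfold flux; ring).
  eapply Rle_trans; [apply Rabs_triang|].
  replace (eps * L * L) with ((d - c) * (eps * L) + (b - a) * (eps * L))
    by (unfold L; ring).
  lra.
Qed.

Section Bisection.
Variables (A B K : R).
Hypothesis HA : 0 < A.
Hypothesis HB : 0 < B.

(* A scaled-down rectangle, given by its lower left corner and its scale l, is bad
   when its flux exceeds K * l^2; one of its quarters is then bad too. *)
Let bad (t : R * R * R) : Prop := let '(x, y, l) := t in
  K * (l * l) < Rabs (flux u v x (x + l * A) y (y + l * B)).
Let child (t t' : R * R * R) : Prop :=
  let '(x, y, l) := t in let '(x', y', l') := t' in
  l' = l / 2 /\ (x' = x \/ x' = x + l / 2 * A) /\ (y' = y \/ y' = y + l / 2 * B).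
Let inside (t : R * R * R) : Prop := let '(x, y, l) := t in 0 < l /\ x + l * A < X.

Lemma child_inside (t t' : R * R * R) : child t t' -> inside t -> inside t'.
Proof.
  destruct t as [[x y] l], t' as [[x' y'] l']. simpl.
  intros [-> [Hx Hy]] [Hl HX]. split; [lra|].
  pose proof (Rmult_lt_0_compat _ _ Hl HA). destruct Hx as [-> | ->]; lra.
Qed.

(** By [flux_split] the flux is the sum over the four quarters, and 4 K (l/2)^2 = K l^2. *)
Lemma bad_child (t : R * R * R) : inside t -> bad t -> exists t', child t t' /\ bad t'.
Proof.
  destruct t as [[x y] l]. intros [Hl Hlx] Hb. apply NNPP. intros Hn.
  assert (G : forall x' y', (x' = x \/ x' = x + l / 2 * A) ->
     (y' = y \/ y' = y + l / 2 * B) ->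
    Rabs (flux u v x' (x' + l / 2 * A) y' (y' + l / 2 * B)) <= K * (l / 2 * (l / 2))).
  { intros x' y' Hx' Hy'. apply Rnot_lt_le. intros HH. apply Hn.
    exists (x', y', l / 2). simpl. auto. }
  pose proof (Rmult_lt_0_compat _ _ Hl HA).
  unfold bad in Hb.
  rewrite (flux_split x (x + l / 2 * A) (x + l * A) y (y + l / 2 * B) (y + l * B)) in Hb by lra.
  pose proof (G x y (or_introl eq_refl) (or_introl eq_refl)) as G1.
  pose proof (G x (y + l / 2 * B) (or_introl eq_refl) (or_intror eq_refl)) as G2.
  pose proof (G (x + l / 2 * A) y (or_intror eq_refl) (or_introl eq_refl)) as G3.
  pose proof (G (x + l / 2 * A) (y + l / 2 * B) (or_intror eq_refl) (or_intror eq_refl)) as G4.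
  replace (x + l / 2 * A + l / 2 * A) with (x + l * A) in * by field.
  replace (y + l / 2 * B + l / 2 * B) with (y + l * B) in * by field.
  apply Rabs_le_between in G1. apply Rabs_le_between in G2.
  apply Rabs_le_between in G3. apply Rabs_le_between in G4.
  revert Hb. apply Rle_not_lt. apply Rabs_le. split; lra.
Qed.

Lemma nested_rectangles (a c : R) : a + A < X -> bad (a, c, 1) ->
  exists x0 y0, x0 < X /\ forall n, exists x y,
    x <= x0 <= x + / 2 ^ n * A /\ y <= y0 <= y + / 2 ^ n * B /\
    x + / 2 ^ n * A < X /\ bad (x, y, / 2 ^ n).
Proof.
  intros HaX Hbad.
  (* The hypotheses on [t] sit inside the chosen relation so that it is total; other triples are
     sent to themselves. *)
  destruct (functional_choice (fun t t' => inside t -> bad t -> child t t' /\ bad t'))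
    as [f Hf].
  { intros t. destruct (classic (inside t /\ bad t)) as [[H1 H2] | H].
    - destruct (bad_child t H1 H2) as [t' Ht']. exists t'. auto.
    - exists t. tauto. }
  pose (T := fun n => Nat.iter n f (a, c, 1)).
  assert (HT : forall n, inside (T n) /\ bad (T n)).
  { induction n as [|n [IH1 IH2]].
    - split; [simpl; lra|exact Hbad].
    - change (T (S n)) with (f (T n)). destruct (Hf _ IH1 IH2) as [H1 H2].
      split; [exact (child_inside _ _ H1 IH1)|exact H2]. }
  assert (Hch : forall n, child (T n) (T (S n))).
  { intros n. destruct (HT n). now apply Hf. }
  assert (Hl : forall n, snd (T n) = / 2 ^ n).
  { induction n as [|n IH]; [simpl; field|].
    specialize (Hch n). destruct (T n) as [[x y] l], (T (S n)) as [[x' y'] l'].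
    simpl in *. destruct Hch as [-> _]. rewrite IH.
    assert (2 ^ n <> 0) by (apply pow_nonzero; lra). field; auto. }
  destruct (nested_intervals (fun n => fst (fst (T n))) (fun n => fst (fst (T n)) + snd (T n) * A))
    as [x0 Hx0].
  1-3: intros n; specialize (Hch n); specialize (HT n);
    destruct (T n) as [[x y] l], (T (S n)) as [[x' y'] l'];
    simpl in *; destruct HT as [[Hl0 _] _]; destruct Hch as [-> [Hx Hy]];
    pose proof (Rmult_lt_0_compat _ _ Hl0 HA); try destruct Hx as [-> | ->]; lra.
  destruct (nested_intervals (fun n => snd (fst (T n))) (fun n => snd (fst (T n)) + snd (T n) * B))
    as [y0 Hy0].
  1-3: intros n; specialize (Hch n); specialize (HT n);
    destruct (T n) as [[x y] l], (T (S n)) as [[x' y'] l'];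
    simpl in *; destruct HT as [[Hl0 _] _]; destruct Hch as [-> [Hx Hy]];
    pose proof (Rmult_lt_0_compat _ _ Hl0 HB); try destruct Hy as [-> | ->]; lra.
  exists x0, y0. split.
  { specialize (Hx0 0%nat). simpl in Hx0. lra. }
  intros n. exists (fst (fst (T n))), (snd (fst (T n))).
  specialize (Hx0 n). specialize (Hy0 n). destruct (HT n) as [H1 H2].
  specialize (Hl n). destruct (T n) as [[x y] l]. simpl in *. subst l. tauto.
Qed.
End Bisection.

Lemma Goursat (a b c d : R) : a < b -> b < X -> c < d -> flux u v a b c d = 0.
Proof.
  intros Hab HbX Hcd. apply NNPP. intros Hn. apply Rabs_pos_lt in Hn.
  (* Half of the flux, because [bad] is a strict inequality. *)
  set (K := Rabs (flux u v a b c d) / 2).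
  destruct (nested_rectangles (b - a) (d - c) K) with (a := a) (c := c)
    as [x0 [y0 [Hx0 HH]]]; [lra|lra|lra| |].
  { replace (a + 1 * (b - a)) with b by ring.
    replace (c + 1 * (d - c)) with d by ring. unfold K. lra. }
  set (L := (b - a) + (d - c)).
  assert (HL : 0 < L) by (unfold L; lra).
  (* A rectangle of scale l has width plus height l L, so this epsilon bounds its flux by exactly K
     l^2. *)
  destruct (flux_small x0 y0 (K / (L * L))) as [del [Hdel Hs]]; [exact Hx0| |].
  { apply Rdiv_lt_0_compat; [unfold K; lra|nra]. }
  destruct (pow_lt_1_zero (/ 2)) with (y := del / L) as [n Hn1].
  { rewrite Rabs_pos_eq; lra. }
  { now apply Rdiv_lt_0_compat. }
  specialize (Hn1 n (le_n n)). rewrite pow_inv in Hn1.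
  destruct (HH n) as [x [y [H1 [H2 [H3 H4]]]]].
  set (l := / 2 ^ n) in *.
  assert (Hl : 0 < l) by (apply Rinv_0_lt_compat, pow_lt; lra).
  rewrite Rabs_pos_eq in Hn1 by lra.
  assert (HlL : l * L < del).
  { replace del with (del / L * L) by (field; lra). now apply Rmult_lt_compat_r. }
  assert (HlL2 : l * L = l * (b - a) + l * (d - c)) by (unfold L; ring).
  pose proof (Rmult_lt_0_compat l (b - a) Hl ltac:(lra)).
  pose proof (Rmult_lt_0_compat l (d - c) Hl ltac:(lra)).
  specialize (Hs x (x + l * (b - a)) y (y + l * (d - c)) H1 H2 H3 ltac:(lra) ltac:(lra)).
  revert Hs. apply Rlt_not_le.
  replace (K / (L * L) * (x + l * (b - a) - x + (y + l * (d - c) - y))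
     * (x + l * (b - a) - x + (y + l * (d - c) - y))) with (K * (l * l)); [exact H4|].
  unfold L. field. unfold L in HL. lra.
Qed.
End Goursat.

(** * Complex differentiability, the exponential and the mean value bound *)

Definition cdiff (g : C -> C) (z : C) : Prop :=
  exists l : C, forall eps, 0 < eps -> exists del, 0 < del /\
    forall w, Cmod (w - z) < del ->
      Cmod (g w - g z - l * (w - z)) <= eps * Cmod (w - z).

Lemma Cmod_le_abs (x y : R) : Cmod (x, y) <= Rabs x + Rabs y.
Proof.
  unfold Cmod. simpl. pose proof (Rabs_pos x). pose proof (Rabs_pos y).
  rewrite <- (sqrt_pow2 (Rabs x + Rabs y)) by lra.
  apply sqrt_le_1_alt. rewrite <- (pow2_abs x) at 1.
  pose proof (pow2_abs x). pose proof (pow2_abs y). nra.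
Qed.

Lemma fst_le_Cmod (z : C) : Rabs (fst z) <= Cmod z.
Proof. eapply Rle_trans; [apply Rmax_l|apply Rmax_Cmod]. Qed.

Lemma snd_le_Cmod (z : C) : Rabs (snd z) <= Cmod z.
Proof. eapply Rle_trans; [apply Rmax_r|apply Rmax_Cmod]. Qed.

Lemma cdiff_quadratic (g : C -> C) (z l : C) (K r : R) : 0 < r -> 0 <= K ->
  (forall w, Cmod (w - z) < r ->
     Cmod (g w - g z - l * (w - z)) <= K * (Cmod (w - z) * Cmod (w - z))) ->
  cdiff g z.
Proof.
  intros Hr HK H. exists l. intros eps Heps.
  exists (Rmin r (eps / (K + 1))). split.
  { apply Rmin_pos; [exact Hr|]. apply Rdiv_lt_0_compat; lra. }
  intros w Hw. eapply Rle_trans; [apply H|].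
  { exact (Rlt_le_trans _ _ _ Hw (Rmin_l _ _)). }
  pose proof (Rlt_le_trans _ _ _ Hw (Rmin_r _ _)) as H1.
  pose proof (Cmod_ge_0 (w - z)) as H0.
  assert (Cmod (w - z) * (K + 1) < eps).
  { replace eps with (eps / (K + 1) * (K + 1)) by (field; lra).
    apply Rmult_lt_compat_r; lra. }
  nra.
Qed.

Lemma cdiff_comp (g m : C -> C) (z : C) : cdiff m z -> cdiff g (m z) ->
  cdiff (fun w => g (m w)) z.
Proof.
  intros [lm Hm] [lg Hg]. exists (lg * lm)%C. intros eps Heps.
  pose proof (Cmod_ge_0 lm) as Plm. pose proof (Cmod_ge_0 lg) as Plg.
  destruct (Hg (eps / (2 * (Cmod lm + 1)))) as [dg [Hdg HG]].
  { apply Rdiv_lt_0_compat; lra. }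
  (* The 1 makes [m] Lipschitz near [z] with constant |lm| + 1; the other entry pays for the second
     half of [eps]. *)
  destruct (Hm (Rmin 1 (eps / (2 * (Cmod lg + 1))))) as [dm [Hdm HM]].
  { apply Rmin_pos; [lra|]. apply Rdiv_lt_0_compat; lra. }
  exists (Rmin dm (dg / (Cmod lm + 1))). split.
  { apply Rmin_pos; [lra|]. apply Rdiv_lt_0_compat; lra. }
  intros w Hw.
  pose proof (Rlt_le_trans _ _ _ Hw (Rmin_l _ _)) as Hw1.
  pose proof (Rlt_le_trans _ _ _ Hw (Rmin_r _ _)) as Hw2.
  pose proof (Cmod_ge_0 (w - z)) as H0.
  specialize (HM w Hw1).
  assert (E : Cmod (m w - m z) <= (Cmod lm + 1) * Cmod (w - z)).
  { replace (m w - m z)%C with ((m w - m z - lm * (w - z)) + lm * (w - z))%C by ring.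
    eapply Rle_trans; [apply Cmod_triangle|]. rewrite Cmod_mult.
    assert (Rmin 1 (eps / (2 * (Cmod lg + 1))) * Cmod (w - z) <= 1 * Cmod (w - z))
      by (apply Rmult_le_compat_r; [exact H0|apply Rmin_l]).
    lra. }
  assert (E2 : Cmod (m w - m z) < dg).
  { eapply Rle_lt_trans; [exact E|].
    replace dg with ((Cmod lm + 1) * (dg / (Cmod lm + 1))) by (field; lra).
    apply Rmult_lt_compat_l; lra. }
  specialize (HG _ E2).
  replace (g (m w) - g (m z) - lg * lm * (w - z))%C with
    ((g (m w) - g (m z) - lg * (m w - m z)) + lg * (m w - m z - lm * (w - z)))%C by ring.
  eapply Rle_trans; [apply Cmod_triangle|]. rewrite Cmod_mult.
  assert (B1 : Cmod (g (m w) - g (m z) - lg * (m w - m z)) <= eps / 2 * Cmod (w - z)).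
  { eapply Rle_trans; [exact HG|].
    replace (eps / 2 * Cmod (w - z)) with
      (eps / (2 * (Cmod lm + 1)) * ((Cmod lm + 1) * Cmod (w - z))) by (field; lra).
    apply Rmult_le_compat_l; [|exact E]. apply Rlt_le, Rdiv_lt_0_compat; lra. }
  assert (B2 : Cmod lg * Cmod (m w - m z - lm * (w - z)) <= eps / 2 * Cmod (w - z)).
  { apply Rle_trans with (Cmod lg * (eps / (2 * (Cmod lg + 1)) * Cmod (w - z))).
    - apply Rmult_le_compat_l; [exact Plg|]. eapply Rle_trans; [exact HM|].
      apply Rmult_le_compat_r; [exact H0|apply Rmin_r].
    - replace (eps / 2 * Cmod (w - z)) with
        ((Cmod lg + 1) * (eps / (2 * (Cmod lg + 1)) * Cmod (w - z))) by (field; lra).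
      apply Rmult_le_compat_r; [|lra].
      apply Rmult_le_pos; [|exact H0]. apply Rlt_le, Rdiv_lt_0_compat; lra. }
  lra.
Qed.

Lemma cdiff_affine (a b z : C) : cdiff (fun w => a + b * w)%C z.
Proof.
  apply (cdiff_quadratic _ _ b 0 1); [lra|lra|]. intros w _.
  replace (a + b * w - (a + b * z) - b * (w - z))%C with (RtoC 0) by ring.
  rewrite Cmod_0. lra.
Qed.

Lemma cdiff_scal (c : C) (g : C -> C) (z : C) : cdiff g z -> cdiff (fun w => c * g w)%C z.
Proof.
  intros H.
  destruct (cdiff_comp (fun w => 0 + c * w)%C g z H (cdiff_affine _ _ _)) as [l Hl].
  exists l. intros eps Heps. destruct (Hl eps Heps) as [d [Hd H2]].
  exists d; split; [exact Hd|]. intros w Hw. specialize (H2 w Hw).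
  now rewrite !Cplus_0_l in H2.
Qed.

Lemma cdiff_continuous (g : C -> C) (z : C) : cdiff g z ->
  forall eps, 0 < eps -> exists del, 0 < del /\
    forall w, Cmod (w - z) < del -> Cmod (g w - g z) < eps.
Proof.
  intros [l H] eps Heps. destruct (H 1 Rlt_0_1) as [d [Hd H1]].
  pose proof (Cmod_ge_0 l).
  exists (Rmin d (eps / (Cmod l + 1))). split.
  { apply Rmin_pos; [lra|]. apply Rdiv_lt_0_compat; lra. }
  intros w Hw.
  specialize (H1 w (Rlt_le_trans _ _ _ Hw (Rmin_l _ _))).
  pose proof (Rlt_le_trans _ _ _ Hw (Rmin_r _ _)) as Hw2.
  replace (g w - g z)%C with ((g w - g z - l * (w - z)) + l * (w - z))%C by ring.
  eapply Rle_lt_trans; [apply Cmod_triangle|]. rewrite Cmod_mult.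
  assert ((Cmod l + 1) * Cmod (w - z) < eps).
  { replace eps with ((Cmod l + 1) * (eps / (Cmod l + 1))) by (field; lra).
    apply Rmult_lt_compat_l; lra. }
  lra.
Qed.

Definition Cexp (z : C) : C := (exp (fst z) * cos (snd z), exp (fst z) * sin (snd z)).

Lemma Cexp_plus (z w : C) : Cexp (z + w) = (Cexp z * Cexp w)%C.
Proof.
  unfold Cexp, Cmult, Cplus. simpl. rewrite exp_plus, cos_plus, sin_plus.
  f_equal; ring.
Qed.

Lemma Cmod_Cexp (z : C) : Cmod (Cexp z) = exp (fst z).
Proof.
  unfold Cmod, Cexp. simpl.
  pose proof (sin2_cos2 (snd z)) as H. unfold Rsqr in H.
  replace (_ + _) with (exp (fst z) ^ 2).
  - rewrite sqrt_pow2; [reflexivity|]. apply Rlt_le, exp_pos.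
  - transitivity (exp (fst z) ^ 2 * (sin (snd z) * sin (snd z) + cos (snd z) * cos (snd z)));
      [rewrite H|]; ring.
Qed.

Lemma derivable_pt_lim_0_eps (f : R -> R) (l : R) : derivable_pt_lim f 0 l ->
  forall eps, 0 < eps -> exists del, 0 < del /\
    forall h, Rabs h < del -> Rabs (f h - f 0 - l * h) <= eps * Rabs h.
Proof.
  intros H eps Heps. destruct (H eps Heps) as [[d Hd] Hl]. simpl in Hl.
  exists d; split; [exact Hd|]. intros h Hh.
  destruct (Req_dec h 0) as [-> | Hn].
  { replace (f 0 - f 0 - l * 0) with 0 by ring. rewrite Rabs_R0. lra. }
  specialize (Hl h Hn Hh). rewrite Rplus_0_l in Hl.
  replace (f h - f 0 - l * h) with (((f h - f 0) / h - l) * h) by (field; exact Hn).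
  rewrite Rabs_mult. apply Rmult_le_compat_r; [apply Rabs_pos|lra].
Qed.

Lemma cdiff_Cexp_0 : forall eps, 0 < eps -> exists del, 0 < del /\
  forall h, Cmod h < del -> Cmod (Cexp h - 1 - h) <= eps * Cmod h.
Proof.
  (* The four error terms below add up to at most 6 eps |h|; the cap 1 keeps |exp x| <= 2. *)
  intros eps0 Heps0. set (eps := Rmin 1 (eps0 / 8)).
  assert (Heps : 0 < eps) by (apply Rmin_pos; lra).
  assert (He1 : eps <= 1) by apply Rmin_l.
  assert (He2 : eps <= eps0 / 8) by apply Rmin_r.
  destruct (derivable_pt_lim_0_eps exp 1) with (eps := eps) as [d1 [Hd1 H1]]; auto.
  { pose proof (derivable_pt_lim_exp 0) as H. now rewrite exp_0 in H. }
  destruct (derivable_pt_lim_0_eps cos 0) with (eps := eps) as [d2 [Hd2 H2]]; auto.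
  { pose proof (derivable_pt_lim_cos 0) as H. now rewrite sin_0, Ropp_0 in H. }
  destruct (derivable_pt_lim_0_eps sin 1) with (eps := eps) as [d3 [Hd3 H3]]; auto.
  { pose proof (derivable_pt_lim_sin 0) as H. now rewrite cos_0 in H. }
  exists (Rmin (Rmin d1 (eps / 2)) (Rmin d2 d3)). split.
  { repeat apply Rmin_pos; lra. }
  intros [x y] Hh.
  pose proof (fst_le_Cmod (x, y)) as Hx. pose proof (snd_le_Cmod (x, y)) as Hy.
  simpl in Hx, Hy. set (m := Cmod (x, y)) in *.
  pose proof (Rlt_le_trans _ _ _ Hh (Rmin_l _ _)) as K1.
  pose proof (Rlt_le_trans _ _ _ Hh (Rmin_r _ _)) as K2.
  pose proof (Rlt_le_trans _ _ _ K1 (Rmin_l _ _)).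
  pose proof (Rlt_le_trans _ _ _ K1 (Rmin_r _ _)).
  pose proof (Rlt_le_trans _ _ _ K2 (Rmin_l _ _)).
  pose proof (Rlt_le_trans _ _ _ K2 (Rmin_r _ _)).
  specialize (H1 x ltac:(lra)). specialize (H2 y ltac:(lra)). specialize (H3 y ltac:(lra)).
  rewrite exp_0 in H1. rewrite cos_0 in H2. rewrite sin_0 in H3.
  pose proof (Rabs_pos x) as Px. pose proof (Rabs_pos y) as Py.
  assert (eps * Rabs x <= eps * m) by (apply Rmult_le_compat_l; lra).
  assert (eps * Rabs y <= eps * m) by (apply Rmult_le_compat_l; lra).
  assert (Ee : Rabs (exp x - 1) <= eps).
  { replace (exp x - 1) with ((exp x - 1 - 1 * x) + x) by ring.
    eapply Rle_trans; [apply Rabs_triang|]. nra. }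
  assert (Ee2 : Rabs (exp x) <= 2).
  { replace (exp x) with ((exp x - 1) + 1) by ring.
    eapply Rle_trans; [apply Rabs_triang|]. rewrite Rabs_R1. lra. }
  pose proof (Rabs_pos (exp x)).
  unfold Cexp, Cminus, Cplus, Copp, RtoC. simpl.
  eapply Rle_trans; [apply Cmod_le_abs|].
  replace (exp x * cos y + - (1) + - x) with
    ((exp x - 1 - 1 * x) + exp x * (cos y - 1 - 0 * y)) by ring.
  replace (exp x * sin y + -0 + - y) with
    (exp x * (sin y - 0 - 1 * y) + (exp x - 1) * y) by ring.
  assert (T1 : Rabs (exp x * (cos y - 1 - 0 * y)) <= 2 * (eps * m)).
  { rewrite Rabs_mult. apply Rmult_le_compat; try apply Rabs_pos; lra. }
  assert (T2 : Rabs (exp x * (sin y - 0 - 1 * y)) <= 2 * (eps * m)).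
  { rewrite Rabs_mult. apply Rmult_le_compat; try apply Rabs_pos; lra. }
  assert (T3 : Rabs ((exp x - 1) * y) <= eps * m).
  { rewrite Rabs_mult. apply Rmult_le_compat; try apply Rabs_pos; lra. }
  pose proof (Rabs_triang (exp x - 1 - 1 * x) (exp x * (cos y - 1 - 0 * y))).
  pose proof (Rabs_triang (exp x * (sin y - 0 - 1 * y)) ((exp x - 1) * y)).
  assert (8 * eps * m <= eps0 * m) by (apply Rmult_le_compat_r; lra).
  assert (0 <= eps * m) by (apply Rmult_le_pos; lra).
  lra.
Qed.

Lemma cdiff_Cexp (z : C) : cdiff Cexp z.
Proof.
  exists (Cexp z). intros eps Heps.
  assert (P : 0 < Cmod (Cexp z)) by (rewrite Cmod_Cexp; apply exp_pos).
  destruct (cdiff_Cexp_0 (eps / Cmod (Cexp z))) as [d [Hd H]].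
  { now apply Rdiv_lt_0_compat. }
  exists d; split; [exact Hd|]. intros w Hw. specialize (H _ Hw).
  replace (Cexp w) with (Cexp z * Cexp (w - z))%C
    by (rewrite <- Cexp_plus; f_equal; ring).
  replace (Cexp z * Cexp (w - z) - Cexp z - Cexp z * (w - z))%C
    with (Cexp z * (Cexp (w - z) - 1 - (w - z)))%C by ring.
  rewrite Cmod_mult.
  replace (eps * Cmod (w - z)) with
    (Cmod (Cexp z) * (eps / Cmod (Cexp z) * Cmod (w - z))) by (field; lra).
  apply Rmult_le_compat_l; lra.
Qed.

Lemma cdiff_CR (F : C -> C) (x y : R) : cdiff F (x, y) ->
  CR_at (fun x y => fst (F (x, y))) (fun x y => snd (F (x, y))) x y.
Proof.
  intros [[al be] H]. exists al, be. intros eps Heps.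
  destruct (H eps Heps) as [d [Hd H1]].
  exists (d / 2); split; [lra|]. intros x' y' Hx Hy.
  specialize (H1 (x', y')).
  assert (E : Cmod ((x', y') - (x, y))%C <= Rabs (x' - x) + Rabs (y' - y))
    by apply Cmod_le_abs.
  specialize (H1 ltac:(lra)).
  assert (E2 : eps * Cmod ((x', y') - (x, y))%C <= eps * (Rabs (x' - x) + Rabs (y' - y)))
    by (apply Rmult_le_compat_l; lra).
  pose proof (fst_le_Cmod (F (x', y') - F (x, y) - (al, be) * ((x', y') - (x, y)))%C) as P1.
  pose proof (snd_le_Cmod (F (x', y') - F (x, y) - (al, be) * ((x', y') - (x, y)))%C) as P2.
  simpl in P1, P2. split.
  - replace (fst (F (x', y')) - fst (F (x, y)) - (al * (x' - x) - be * (y' - y))) with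
      (fst (F (x', y')) + - fst (F (x, y)) + - (al * (x' + - x) - be * (y' + - y))) by ring.
    lra.
  - replace (snd (F (x', y')) - snd (F (x, y)) - (be * (x' - x) + al * (y' - y))) with
      (snd (F (x', y')) + - snd (F (x, y)) + - (al * (y' + - y) + be * (x' + - x))) by ring.
    lra.
Qed.

(* In the coordinate z = e^(x + iy) the circles around 0 become vertical segments of
   length 2 PI, on which Goursat makes the mean of g independent of x. *)
Lemma mean_value_Re (g : C -> C) (rho M : R) : 0 < rho < 1 ->
  (forall z, Cmod z < 1 -> cdiff g z) ->
  (forall z, Cmod z = rho -> fst (g z) <= M) -> fst (g 0) <= M.
Proof.
  intros Hrho Hg HM. apply Rnot_lt_le. intros Hlt.
  set (F := fun z => g (Cexp z)).
  assert (HF : forall x y, x < 0 ->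
     CR_at (fun x y => fst (F (x, y))) (fun x y => snd (F (x, y))) x y).
  { intros x y Hx. apply cdiff_CR. apply (cdiff_comp g Cexp); [apply cdiff_Cexp|].
    apply Hg. rewrite Cmod_Cexp. simpl. rewrite <- exp_0. now apply exp_increasing. }
  (* The mean of Re g is at most M over the circle of radius rho and at least M + e over a small
     circle around 0, while Goursat makes the two means equal. *)
  set (e := (fst (g 0) - M) / 2).
  destruct (cdiff_continuous g 0 (Hg 0 ltac:(rewrite Cmod_0; lra)) e) as [d [Hd Hc]].
  { unfold e; lra. }
  set (b := ln rho).
  assert (Hb : b < 0) by (unfold b; rewrite <- ln_1; apply ln_increasing; lra).
  (* Since e^a <= d/2, the left side maps into the disc where g is within [e] of g(0); [b - 1]
     ensures a < b. *)
  set (a := Rmin (ln (d / 2)) (b - 1)).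
  assert (Hab : a < b).
  { pose proof (Rmin_r (ln (d / 2)) (b - 1)). unfold a. lra. }
  pose proof PI_RGT_0 as Hpi.
  pose proof (Goursat _ _ 0 HF a b 0 (2 * PI) Hab Hb ltac:(lra)) as G.
  rewrite (flux_eq _ _ 0 HF) in G by lra.
  (* Periodicity cancels the horizontal sides; dz = i dy on the vertical ones, so only Re g is
     integrated there. *)
  assert (E : RInt (fun x => snd (F (x, 0))) a b = RInt (fun x => snd (F (x, 2 * PI))) a b).
  { apply RInt_ext. intros x _. unfold F, Cexp. simpl.
    now rewrite sin_2PI, cos_2PI, sin_0, cos_0. }
  rewrite E in G.
  assert (U : RInt (fun y => fst (F (b, y))) 0 (2 * PI) <= RInt (fun _ => M) 0 (2 * PI)).
  { apply RInt_le; [lra| |apply ex_RInt_const|].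
    - apply (ex_RInt_vert _ _ 0 HF). exact Hb.
    - intros y _. apply HM. rewrite Cmod_Cexp. apply exp_ln. lra. }
  assert (L : RInt (fun _ => M + e) 0 (2 * PI) <= RInt (fun y => fst (F (a, y))) 0 (2 * PI)).
  { apply RInt_le; [lra|apply ex_RInt_const| |].
    - apply (ex_RInt_vert _ _ 0 HF). lra.
    - intros y _. unfold F.
      assert (Ha : Cmod (Cexp (a, y) - 0) < d).
      { replace (Cexp (a, y) - 0)%C with (Cexp (a, y)) by ring.
        rewrite Cmod_Cexp. simpl.
        apply Rle_lt_trans with (d / 2); [|lra].
        rewrite <- (exp_ln (d / 2)) by lra.
        destruct (Rmin_l (ln (d / 2)) (b - 1)) as [h | h]; fold a in h.
        - left. now apply exp_increasing.
        - rewrite h. right. reflexivity. }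
      specialize (Hc _ Ha).
      pose proof (fst_le_Cmod (g (Cexp (a, y)) - g 0)%C) as P. simpl in P.
      assert (P2 : Rabs (fst (g (Cexp (a, y))) + - fst (g 0)) < e) by lra.
      apply Rabs_def2 in P2. unfold e in *. lra. }
  rewrite (RInt_const (V := R_CompleteNormedModule)) in U, L.
  change (scal (2 * PI - 0) M) with ((2 * PI - 0) * M) in U.
  change (scal (2 * PI - 0) (M + e)) with ((2 * PI - 0) * (M + e)) in L.
  assert (0 < PI * e) by (apply Rmult_lt_0_compat; unfold e; lra).
  lra.
Qed.

(** Multiplying g by the conjugate of g(0) turns the value at 0 into the real number |g(0)|^2, so
    the bound for real parts applies with |g(0)| M. *)
Lemma mean_value_bound (g : C -> C) (rho M : R) : 0 < rho < 1 ->
  (forall z, Cmod z < 1 -> cdiff g z) ->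
  (forall z, Cmod z = rho -> Cmod (g z) <= M) -> Cmod (g 0) <= M.
Proof.
  intros Hrho Hg HM.
  pose proof (Cmod_ge_0 (g 0)) as P0.
  assert (E : fst (Cconj (g 0) * g 0)%C = Cmod (g 0) * Cmod (g 0)).
  { unfold Cmod. rewrite sqrt_sqrt by nra. simpl. ring. }
  assert (B : fst (Cconj (g 0) * g 0)%C <= Cmod (g 0) * M).
  { apply (mean_value_Re (fun z => Cconj (g 0) * g z)%C rho); [exact Hrho| |].
    - intros z Hz. apply cdiff_scal. now apply Hg.
    - intros z Hz. eapply Rle_trans; [apply Rle_abs|].
      eapply Rle_trans; [apply fst_le_Cmod|]. rewrite Cmod_mult, Cmod_conj.
      apply Rmult_le_compat_l; [exact P0|]. now apply HM. }
  rewrite E in B.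
  (* If g(0) = 0 there is nothing to divide by; then M >= 0 is read off at the point rho of the
     circle. *)
  destruct P0 as [P0 | P0].
  - now apply Rmult_le_reg_l with (Cmod (g 0)).
  - rewrite <- P0. eapply Rle_trans; [apply (Cmod_ge_0 (g (RtoC rho)))|].
    apply HM. rewrite Cmod_R. apply Rabs_pos_eq. lra.
Qed.

(** * Moebius maps and the maximum principle *)

Lemma Cmod_sqr (z : C) : Cmod z * Cmod z = fst z * fst z + snd z * snd z.
Proof. unfold Cmod. rewrite sqrt_sqrt by nra. ring. Qed.

Lemma Cmod_ge_sub (x y : C) : Cmod x - Cmod y <= Cmod (x + y).
Proof.
  pose proof (Cmod_triangle (x + y) (- y)) as H. rewrite Cmod_opp in H.
  replace (x + y + - y)%C with x in H by ring. lra.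
Qed.

(** The remainder of the linear approximation is exactly - (b - a c) c (w - z)^2 / ((1 + c w) (1 + c
    z)^2), and |1 + c w| >= |1 + c z| / 2 near z. *)
Lemma cdiff_moebius (a b c z : C) : (1 + c * z)%C <> 0 ->
  cdiff (fun w => (a + b * w) / (1 + c * w))%C z.
Proof.
  intros Hz. pose proof (Cmod_gt_0 (1 + c * z)) as Hp.
  assert (P : 0 < Cmod (1 + c * z)) by (now apply Hp). clear Hp.
  set (d := Cmod (1 + c * z)) in *.
  pose proof (Cmod_ge_0 c) as Pc.
  pose proof (Cmod_ge_0 ((b - a * c) * c)) as Pk.
  apply (cdiff_quadratic _ _ ((b - a * c) / ((1 + c * z) * (1 + c * z)))%C
    (Cmod ((b - a * c) * c) * (2 / (d * d * d))) (d / (2 * (Cmod c + 1)))).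
  - apply Rdiv_lt_0_compat; lra.
  - apply Rmult_le_pos; [exact Pk|]. apply Rlt_le, Rdiv_lt_0_compat; [lra|].
    repeat apply Rmult_lt_0_compat; exact P.
  - intros w Hw.
    assert (Q : d / 2 <= Cmod (1 + c * w)).
    { pose proof (Cmod_ge_sub (1 + c * z) (c * (w - z))) as H.
      replace (1 + c * z + c * (w - z))%C with (1 + c * w)%C in H by ring.
      rewrite Cmod_mult in H. fold d in H.
      assert ((Cmod c + 1) * Cmod (w - z) < d / 2).
      { replace (d / 2) with ((Cmod c + 1) * (d / (2 * (Cmod c + 1)))) by (field; lra).
        apply Rmult_lt_compat_l; lra. }
      pose proof (Cmod_ge_0 (w - z)). lra. }
    assert (Hw0 : (1 + c * w)%C <> 0).
    { intros E. rewrite E, Cmod_0 in Q. lra. }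
    replace ((a + b * w) / (1 + c * w) - (a + b * z) / (1 + c * z)
        - (b - a * c) / ((1 + c * z) * (1 + c * z)) * (w - z))%C
      with (- ((b - a * c) * c) * ((w - z) * (w - z)) *
            / ((1 + c * w) * ((1 + c * z) * (1 + c * z))))%C by (field; split; assumption).
    rewrite Cmod_mult, Cmod_mult, Cmod_opp, Cmod_mult, Cmod_mult.
    rewrite Cmod_inv by (repeat apply Cmult_neq_0; assumption).
    rewrite !Cmod_mult. fold d. rewrite <- Cmod_mult.
    replace (Cmod ((b - a * c) * c) * (2 / (d * d * d)) * (Cmod (w - z) * Cmod (w - z)))
      with (Cmod ((b - a * c) * c) * (Cmod (w - z) * Cmod (w - z)) * (2 / (d * d * d))) by ring.
    apply Rmult_le_compat_l.
    { pose proof (Cmod_ge_0 (w - z)). repeat apply Rmult_le_pos; assumption. }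
    replace (2 / (d * d * d)) with (/ (d / 2 * (d * d))) by (field; lra).
    apply Rinv_le_contravar.
    + repeat apply Rmult_lt_0_compat; lra.
    + apply Rmult_le_compat_r; [nra|exact Q].
Qed.

Lemma moebius_modulus (a z : C) :
  Cmod (z + a) * Cmod (z + a) - Cmod (1 + Cconj a * z) * Cmod (1 + Cconj a * z)
  = (1 - Cmod a * Cmod a) * (Cmod z * Cmod z - 1).
Proof. rewrite !Cmod_sqr. simpl. ring. Qed.

(** An automorphism of the disc |z| < rho carries 0 to [z0], so the mean value bound at the centre
    gives the bound at [z0]. *)
Lemma maximum_principle (g : C -> C) (rho M : R) (z0 : C) : 0 < rho < 1 ->
  (forall z, Cmod z < 1 -> cdiff g z) ->
  (forall z, Cmod z = rho -> Cmod (g z) <= M) ->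
  Cmod z0 < rho -> Cmod (g z0) <= M.
Proof.
  intros Hrho Hg HM Hz0.
  assert (Hr0 : RtoC rho <> 0) by (intros E; apply (f_equal fst) in E; simpl in E; lra).
  set (a := (z0 / rho)%C).
  assert (Ha : Cmod a < 1).
  { unfold a. rewrite Cmod_div, Cmod_R, Rabs_pos_eq by (assumption || lra).
    apply Rlt_div_l; lra. }
  pose proof (Cmod_ge_0 a) as Ha0.
  set (k := 1 - Cmod a).
  (* The Moebius map is used on the slightly larger disc |z| < r. *)
  set (eta := (1 - rho * rho) * k / 48).
  set (r := 1 + eta).
  assert (Heta : 0 < eta).
  { unfold eta, k. apply Rdiv_lt_0_compat; [|lra]. apply Rmult_lt_0_compat; nra. }
  assert (Heta2 : eta <= k / 48).
  { unfold eta. apply Rmult_le_compat_r; [lra|]. unfold k. nra. }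
  assert (HD : forall z, Cmod z < r -> k / 2 <= Cmod (1 + Cconj a * z)).
  { intros z Hz. pose proof (Cmod_ge_sub 1 (Cconj a * z)) as H.
    rewrite Cmod_1, Cmod_mult, Cmod_conj in H.
    assert (Cmod a * Cmod z <= Cmod a * r) by (apply Rmult_le_compat_l; lra).
    assert (Cmod a * r <= Cmod a + eta) by (unfold r; nra).
    unfold k in *. lra. }
  assert (HD0 : forall z, Cmod z < r -> (1 + Cconj a * z)%C <> 0).
  { intros z Hz E. specialize (HD z Hz). rewrite E, Cmod_0 in HD. unfold k in HD. lra. }
  set (mu := fun w => ((rho * a + (rho * r) * w) / (1 + (Cconj a * r) * w))%C).
  assert (HmuE : forall w, Cmod w < 1 ->
    Cmod (r * w) = r * Cmod w /\ Cmod (r * w) < r /\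
    Cmod (mu w) = rho * Cmod (r * w + a) / Cmod (1 + Cconj a * (r * w))).
  { intros w Hw.
    assert (E : Cmod (r * w) = r * Cmod w).
    { rewrite Cmod_mult, Cmod_R, Rabs_pos_eq; [reflexivity|unfold r; lra]. }
    assert (E2 : Cmod (r * w) < r) by (rewrite E; unfold r in *; nra).
    split; [exact E|split; [exact E2|]].
    unfold mu.
    replace (rho * a + rho * r * w)%C with (rho * (r * w + a))%C by ring.
    replace (1 + Cconj a * r * w)%C with (1 + Cconj a * (r * w))%C by ring.
    rewrite Cmod_div by (now apply HD0).
    rewrite Cmod_mult, Cmod_R, (Rabs_pos_eq rho) by lra. reflexivity. }
  replace z0 with (mu 0%C).
  2:{ unfold mu, a. field. exact Hr0. }
  (* On |w| = 1/r the point r w has modulus 1, so [mu] sends this circle into |z| = rho. The room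
     between 1/r and 1 provides differentiability on the whole disc |w| < 1. *)
  apply (mean_value_bound (fun w => g (mu w)) (/ r)).
  - split; [apply Rinv_0_lt_compat; unfold r; lra|].
    rewrite <- Rinv_1. apply Rinv_lt_contravar; unfold r; lra.
  - intros z Hz. destruct (HmuE z Hz) as [E1 [E2 E3]].
    apply (cdiff_comp g mu).
    + apply cdiff_moebius.
      replace (1 + Cconj a * r * z)%C with (1 + Cconj a * (r * z))%C by ring.
      now apply HD0.
    + apply Hg. rewrite E3. specialize (HD _ E2).
      assert (Hk : 0 < k) by (unfold k; lra).
      apply Rlt_div_l; [lra|]. rewrite Rmult_1_l.
      pose proof (moebius_modulus a (r * z)) as HH.
      set (N := Cmod (r * z + a)) in *.
      set (D := Cmod (1 + Cconj a * (r * z))) in *.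
      assert (HN : 0 <= N) by apply Cmod_ge_0.
      set (x := Cmod (r * z)) in *.
      assert (Hx : 0 <= x) by apply Cmod_ge_0.
      assert (B1 : x * x - 1 <= 3 * eta).
      { assert (x * x <= r * r) by nra. unfold r in *.
        assert (eta <= 1) by (unfold k in *; lra). nra. }
      assert (B2 : (1 - Cmod a * Cmod a) * (x * x - 1) <= 2 * k * (3 * eta)).
      { assert (0 <= 1 - Cmod a * Cmod a <= 2 * k) by (unfold k; nra). nra. }
      (* The 48 in [eta] makes 6 k eta equal to (1 - rho^2) k^2 / 8, half of the (1 - rho^2) k^2 / 4
         <= (1 - rho^2) D^2 that is available. *)
      assert (B3 : rho * N * (rho * N) < D * D).
      { assert (rho * rho * (N * N) <= rho * rho * (D * D + 6 * k * eta)).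
        { apply Rmult_le_compat_l; nra. }
        assert (0 < 6 * k * eta) by nra.
        assert (k * k / 4 <= D * D) by nra.
        assert (48 * eta = (1 - rho * rho) * k) by (unfold eta; field).
        assert (24 * (6 * k * eta) = 3 * (1 - rho * rho) * (k * k)) by nra.
        assert ((1 - rho * rho) * (k * k / 4) <= (1 - rho * rho) * (D * D))
          by (apply Rmult_le_compat_l; nra).
        assert (rho * rho * (6 * k * eta) <= 1 * (6 * k * eta)) by nra.
        assert (0 < (1 - rho * rho) * (k * k)) by nra.
        nra. }
      apply Rnot_le_lt. intros Hle. apply (Rlt_not_le _ _ B3).
      assert (0 <= D) by lra. nra.
  - intros z Hz.
    assert (Hz1 : Cmod z < 1).
    { rewrite Hz, <- Rinv_1. apply Rinv_lt_contravar; unfold r; lra. }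
    destruct (HmuE z Hz1) as [E1 [E2 E3]].
    apply HM. rewrite E3.
    rewrite Hz, Rinv_r in E1 by (unfold r; lra).
    specialize (HD _ E2).
    assert (Hk : 0 < k) by (unfold k; lra).
    pose proof (moebius_modulus a (r * z)) as HH. rewrite E1 in HH.
    assert (E : Cmod (r * z + a) = Cmod (1 + Cconj a * (r * z))).
    { pose proof (Cmod_ge_0 (r * z + a)). nra. }
    rewrite E. field. lra.
Qed.

(** * Contractions: bounds on pi and the singular value decomposition *)

Ltac creal := simpl in *; unfold piM, Ctr, Cdet, M2app, C2norm2, Cmod2, Cadd, Csub, Cmul,
  Defs.Cconj, Cminus, Cplus, Copp, Cmult, Cconj, RtoC in *; simpl in *.

Ltac pairs := repeat match goal with |- (_, _) = (_, _) => apply f_equal2 end.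

(* [ring] does not see that [Defs.C] is Coquelicot's [C]. *)
Ltac cring := change Defs.C with C in *; ring.

Definition norm_le (r : R) (A : M2) : Prop :=
  forall v, C2norm2 (M2app A v) <= r * r * C2norm2 v.

Lemma norm_le_inP (r : R) (A : M2) : 0 <= r < 1 -> norm_le r A -> inP (piM A).
Proof. intros Hr HA. exists A; split; [|reflexivity]. exists r; repeat split; tauto. Qed.

(** The two basis vectors bound the columns, and the conjugate of the second row bounds that row. By
    |s|^2 <= 2 (|m11|^2 + |m22|^2), the first quantity is at most the average of first column and
    second row; the determinant is bounded by Hadamard's inequality. *)
Lemma norm_le_bounds (r : R) (A : M2) (a s p : C) : norm_le r A -> piM A = (a, s, p) ->
  Cmod2 a + / 4 * Cmod2 s <= r * r /\ Cmod2 p <= (r * r) * (r * r).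
Proof.
  intros H [= <- <- <-].
  pose proof (H ((1, 0), (0, 0))) as H1.
  pose proof (H ((0, 0), (1, 0))) as H2.
  pose proof (H (Cconj (m21 A), Cconj (m22 A))) as H3.
  destruct A as [[a1 a2] [b1 b2] [c1 c2] [d1 d2]]. clear H. creal.
  set (col1 := a1 * a1 + a2 * a2 + (c1 * c1 + c2 * c2)).
  set (col2 := b1 * b1 + b2 * b2 + (d1 * d1 + d2 * d2)).
  set (row := c1 * c1 + c2 * c2 + (d1 * d1 + d2 * d2)).
  assert (E1 : col1 <= r * r) by (unfold col1; lra).
  assert (E2 : col2 <= r * r) by (unfold col2; lra).
  assert (E3 : row * row <= r * r * row).
  { eapply Rle_trans; [|eapply Rle_trans; [exact H3|]]; [|unfold row; lra].
    unfold row.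
    match goal with |- ?X <= ?p * ?p + ?q * ?q + _ =>
      pose proof (Rle_0_sqr p) as P1; pose proof (Rle_0_sqr q) as P2 end.
    unfold Rsqr in P1, P2. lra. }
  assert (E4 : row <= r * r).
  { assert (0 <= row) by (unfold row; nra).
    destruct (Req_dec row 0) as [-> | Hn]; [nra|].
    apply Rmult_le_reg_r with row; lra. }
  split.
  - pose proof (Rle_0_sqr (a1 - d1)). pose proof (Rle_0_sqr (a2 - d2)). unfold Rsqr in *.
    unfold col1, row in *. lra.
  - apply Rle_trans with (col1 * col2).
    + (* Lagrange's identity *)
      pose proof (Rle_0_sqr (a1 * b1 + a2 * b2 + c1 * d1 + c2 * d2)).
      pose proof (Rle_0_sqr (a1 * b2 - a2 * b1 + c1 * d2 - c2 * d1)).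
      unfold Rsqr, col1, col2 in *. nra.
    + apply Rmult_le_compat; try assumption; unfold col1, col2; nra.
Qed.

(* z1 u v^* + z2 u' v'^*, where u' = (- conj u2, conj u1) completes a unit vector u
   to an orthonormal basis, and v' likewise. *)
Definition svd (u v : C * C) (z1 z2 : C) : M2 :=
  let (u1, u2) := u in let (v1, v2) := v in
  mkM2 (z1 * (u1 * Cconj v1) + z2 * (Cconj u2 * v2))%C
       (z1 * (u1 * Cconj v2) - z2 * (Cconj u2 * v1))%C
       (z1 * (u2 * Cconj v1) - z2 * (Cconj u1 * v2))%C
       (z1 * (u2 * Cconj v2) + z2 * (Cconj u1 * v1))%C.

(** The trace of u v^*; the trace of u' v'^* is its conjugate. *)
Definition svd_s (u v : C * C) : C :=
  (fst u * Cconj (fst v) + snd u * Cconj (snd v))%C.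

(** Both frames (u, u') and (v, v') have determinant 1, so the third coordinate is [z1 * z2] without
    a phase factor. *)
Lemma piM_svd (u v : C * C) (z1 z2 : C) : C2norm2 u = 1 -> C2norm2 v = 1 ->
  piM (svd u v z1 z2) =
  ((z1 * (snd u * Cconj (fst v)) - z2 * (Cconj (fst u) * snd v))%C,
   (z1 * svd_s u v + z2 * Cconj (svd_s u v))%C, (z1 * z2)%C).
Proof.
  destruct u as [u1 u2], v as [v1 v2]. intros Hu Hv.
  assert (E : Cdet (svd (u1, u2) (v1, v2) z1 z2) =
     (z1 * z2 * ((C2norm2 (u1, u2)) * (C2norm2 (v1, v2))))%C).
  { destruct u1, u2, v1, v2, z1, z2. creal. f_equal; ring. }
  unfold piM. rewrite E, Hu, Hv. unfold svd_s.
  destruct u1, u2, v1, v2, z1, z2. creal. pairs; ring.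
Qed.

Lemma norm_le_svd (u v : C * C) (z1 z2 : C) (r : R) : C2norm2 u = 1 -> C2norm2 v = 1 ->
  Cmod2 z1 <= r * r -> Cmod2 z2 <= r * r -> norm_le r (svd u v z1 z2).
Proof.
  intros Hu Hv H1 H2 w.
  (* X and Y are the coordinates of [w] in the orthonormal basis v, v'; [E] and [F] are Parseval's
     identities. *)
  set (X := (Cconj (fst v) * fst w + Cconj (snd v) * snd w)%C).
  set (Y := (fst v * snd w - snd v * fst w)%C).
  assert (E : C2norm2 (M2app (svd u v z1 z2) w) =
     C2norm2 u * (Cmod2 z1 * Cmod2 X + Cmod2 z2 * Cmod2 Y)).
  { unfold X, Y. destruct u as [[] []], v as [[] []], w as [[] []], z1, z2. creal. ring. }
  assert (F : Cmod2 X + Cmod2 Y = C2norm2 v * C2norm2 w).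
  { unfold X, Y. destruct v as [[] []], w as [[] []]. creal. ring. }
  rewrite E, Hu. rewrite Hv in F.
  assert (PX : 0 <= Cmod2 X) by (unfold Cmod2; nra).
  assert (PY : 0 <= Cmod2 Y) by (unfold Cmod2; nra).
  nra.
Qed.

Lemma C2norm2_unit (w : C * C) : C2norm2 w <> 0 -> exists n k : R,
  k * n = 1 /\ n * n = C2norm2 w.
Proof.
  intros Hw. assert (0 <= C2norm2 w) by (unfold C2norm2, Cmod2; nra).
  assert (0 < sqrt (C2norm2 w)) by (apply sqrt_lt_R0; lra).
  exists (sqrt (C2norm2 w)), (/ sqrt (C2norm2 w)).
  split; [field; lra|now apply sqrt_sqrt].
Qed.

Lemma C2norm2_eq_0 (w : C * C) : C2norm2 w = 0 -> w = (RtoC 0, RtoC 0).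
Proof.
  destruct w as [[p q] [s t]]. intros E. creal.
  assert (p = 0) by nra. assert (q = 0) by nra. assert (s = 0) by nra. assert (t = 0) by nra.
  subst. reflexivity.
Qed.

(** In C^2 the complement of a unit vector u is the line through u' = (- conj u2, conj u1), and [c]
    is the coordinate of [y] along it. *)
Lemma orthogonal_complement (u y : C * C) : C2norm2 u = 1 ->
  (Cconj (fst u) * fst y + Cconj (snd u) * snd y)%C = 0 ->
  let c := (fst u * snd y - snd u * fst y)%C in
  Cmod2 c = C2norm2 y /\ y = ((c * - Cconj (snd u))%C, (c * Cconj (fst u))%C).
Proof.
  destruct u as [u1 u2], y as [y1 y2]. simpl. intros Hu H.
  assert (E : (u1 * Cconj u1 + u2 * Cconj u2)%C = 1).
  { destruct u1, u2. creal. f_equal; [rewrite <- Hu|]; ring. }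
  split.
  - assert (L : Cmod2 (u1 * y2 - u2 * y1)%C + Cmod2 (Cconj u1 * y1 + Cconj u2 * y2)%C
       = C2norm2 (u1, u2) * C2norm2 (y1, y2)).
    { clear. destruct u1, u2, y1, y2. creal. ring. }
    rewrite H, Hu in L. unfold Cmod2 at 2 in L. simpl in L. lra.
  - f_equal.
    + transitivity ((u1 * Cconj u1 + u2 * Cconj u2) * y1
         - u1 * (Cconj u1 * y1 + Cconj u2 * y2))%C; [rewrite E, H|]; ring.
    + transitivity ((u1 * Cconj u1 + u2 * Cconj u2) * y2
         - u2 * (Cconj u1 * y1 + Cconj u2 * y2))%C; [rewrite E, H|]; ring.
Qed.

Lemma orthogonal_pair (x y : C * C) :
  (Cconj (fst x) * fst y + Cconj (snd x) * snd y)%C = 0 ->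
  exists u c1 c2, C2norm2 u = 1 /\ Cmod2 c1 = C2norm2 x /\ Cmod2 c2 = C2norm2 y /\
    x = ((c1 * fst u)%C, (c1 * snd u)%C) /\
    y = ((c2 * - Cconj (snd u))%C, (c2 * Cconj (fst u))%C).
Proof.
  intros H.
  destruct (Req_dec (C2norm2 x) 0) as [Hx | Hx];
    [destruct (Req_dec (C2norm2 y) 0) as [Hy | Hy]|].
  - exists (RtoC 1, RtoC 0), (RtoC 0), (RtoC 0). rewrite Hx, Hy.
    rewrite (C2norm2_eq_0 x Hx), (C2norm2_eq_0 y Hy). clear. creal.
    repeat split; try ring; pairs; ring.
  - destruct (C2norm2_unit y Hy) as [n [k [Hkn Hn]]].
    (* With x = 0 the frame is read off from y: this u has u' = y / |y|. *)
    exists ((k * Cconj (snd y))%C, (- (k * Cconj (fst y)))%C), (RtoC 0), (RtoC n).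
    rewrite Hx. rewrite (C2norm2_eq_0 x Hx). clear H Hx.
    assert (G : forall z, (n * (k * z) = z)%R) by (intros; rewrite <- Rmult_assoc, (Rmult_comm n), Hkn; ring).
    assert (E1 : C2norm2 ((k * Cconj (snd y))%C, (- (k * Cconj (fst y)))%C) = k * k * C2norm2 y)
      by (destruct y as [[] []]; creal; ring).
    rewrite E1, <- Hn. destruct y as [[y1 y2] [y3 y4]].
    repeat split.
    + transitivity ((k * n) * (k * n)); [ring|rewrite Hkn; ring].
    + creal. ring.
    + creal. ring.
    + creal. f_equal; f_equal; ring.
    + creal. f_equal; f_equal; [rewrite <- (G y1) at 1|rewrite <- (G y2) at 1|
        rewrite <- (G y3) at 1|rewrite <- (G y4) at 1]; ring.
  - destruct (C2norm2_unit x Hx) as [n [k [Hkn Hn]]].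
    set (u := ((k * fst x)%C, (k * snd x)%C)).
    assert (Hu : C2norm2 u = 1).
    { assert (E1 : C2norm2 u = k * k * C2norm2 x)
        by (unfold u; destruct x as [[] []]; creal; ring).
      rewrite E1, <- Hn. transitivity ((k * n) * (k * n)); [ring|rewrite Hkn; ring]. }
    assert (Huy : (Cconj (fst u) * fst y + Cconj (snd u) * snd y)%C = 0).
    { transitivity (k * (Cconj (fst x) * fst y + Cconj (snd x) * snd y))%C.
      - unfold u. destruct x as [[] []], y as [[] []]. clear. creal. f_equal; ring.
      - rewrite H. ring. }
    destruct (orthogonal_complement u y Hu Huy) as [H1 H2].
    exists u, (RtoC n), (fst u * snd y - snd u * fst y)%C.
    repeat split; try assumption.
    + rewrite <- Hn. creal. ring.
    + assert (G : (n * k)%C = 1).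
      { rewrite <- RtoC_mult, Rmult_comm, Hkn. reflexivity. }
      unfold u. simpl. rewrite !Cmult_assoc, G, !Cmult_1_l. now destruct x.
Qed.

(* v is an eigenvector of A^* A, whose off-diagonal entry is b and whose diagonal
   entries differ by d: it is proportional to (t, conj b), where t^2 - d t = |b|^2. *)
Lemma eigenvector (d : R) (b : C) : exists v : C * C, C2norm2 v = 1 /\
  (b * (Cconj (fst v) * Cconj (fst v)) - d * (Cconj (fst v) * Cconj (snd v))
   - Cconj b * (Cconj (snd v) * Cconj (snd v)))%C = 0.
Proof.
  destruct (Req_dec (Cmod2 b) 0) as [Hb | Hb].
  - exists (RtoC 1, RtoC 0). destruct b as [b1 b2]. creal.
    assert (b1 = 0) by nra. assert (b2 = 0) by nra. subst.
    split; [ring|f_equal; ring].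
  - assert (P : 0 <= d / 2 * (d / 2) + Cmod2 b) by (unfold Cmod2; nra).
    set (t := d / 2 + sqrt (d / 2 * (d / 2) + Cmod2 b)).
    assert (Ht : t * t - d * t = Cmod2 b).
    { unfold t. pose proof (sqrt_sqrt _ P) as HH.
      set (q := sqrt (d / 2 * (d / 2) + Cmod2 b)) in *. nra. }
    assert (Hn0 : C2norm2 (RtoC t, Cconj b) <> 0).
    { unfold C2norm2, Cmod2 in *. simpl in *. nra. }
    destruct (C2norm2_unit _ Hn0) as [n [k [Hkn Hn]]].
    exists (RtoC (k * t), (k * Cconj b)%C).
    destruct b as [b1 b2]. creal. split.
    + transitivity (k * k * (n * n)); [rewrite Hn; ring|].
      transitivity ((k * n) * (k * n)); [ring|rewrite Hkn; ring].
    + f_equal.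
      * transitivity (b1 * k * k * (t * t - d * t - (b1 * b1 + b2 * b2))); [ring|].
        rewrite Ht. ring.
      * transitivity (b2 * k * k * (t * t - d * t - (b1 * b1 + b2 * b2))); [ring|].
        rewrite Ht. ring.
Qed.

(** The equation of [eigenvector] says that A v and A v' are orthogonal, so [orthogonal_pair] yields
    the left frame. The coefficients have moduli |A v| and |A v'|, both at most |r|. *)
Lemma svd_exists (r : R) (A : M2) : norm_le r A -> exists u v c1 c2,
  C2norm2 u = 1 /\ C2norm2 v = 1 /\ Cmod2 c1 <= r * r /\ Cmod2 c2 <= r * r /\
  A = svd u v c1 c2.
Proof.
  intros HA.
  destruct (eigenvector (Cmod2 (m11 A) + Cmod2 (m21 A) - (Cmod2 (m12 A) + Cmod2 (m22 A)))
    (Cconj (m11 A) * m12 A + Cconj (m21 A) * m22 A)%C) as [v [Hv Hev]].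
  set (v' := ((- Cconj (snd v))%C, Cconj (fst v))).
  destruct (orthogonal_pair (M2app A v) (M2app A v')) as [u [c1 [c2 [Hu [H1 [H2 [H3 H4]]]]]]].
  { rewrite <- Hev. unfold v'. destruct A as [[] [] [] []], v as [[] []]. clear.
    creal. f_equal; ring. }
  exists u, v, c1, c2.
  assert (Hv' : C2norm2 v' = 1).
  { rewrite <- Hv. unfold v'. destruct v as [[] []]. clear. creal. ring. }
  pose proof (HA v) as B1. pose proof (HA v') as B2.
  rewrite <- H1, Hv in B1. rewrite <- H2, Hv' in B2.
  repeat split; try assumption; try lra.
  (* This is A = (A v) v^* + (A v') v'^*, from the resolution of the identity by v, v'. *)
  assert (E : A = mkM2
    (fst (M2app A v) * Cconj (fst v) - fst (M2app A v') * snd v)%C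
    (fst (M2app A v) * Cconj (snd v) + fst (M2app A v') * fst v)%C
    (snd (M2app A v) * Cconj (fst v) - snd (M2app A v') * snd v)%C
    (snd (M2app A v) * Cconj (snd v) + snd (M2app A v') * fst v)%C).
  { assert (G : forall z, z = z * C2norm2 v) by (intros; rewrite Hv; ring).
    unfold v'. destruct A as [[a1 a2] [a3 a4] [a5 a6] [a7 a8]], v as [[] []]. clear - G.
    creal. f_equal; f_equal;
    match goal with |- ?z = _ => rewrite (G z) at 1 end; ring. }
  rewrite E, H3, H4. unfold svd. destruct u as [u1 u2], v as [v1 v2]. simpl fst. simpl snd.
  f_equal; ring.
Qed.

(** * K_0 in equations, and dilated unitary matrices *)

Lemma Cconj_mult_unit (w : C) : Cmod2 w = 1 -> (Cconj w * w)%C = 1.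
Proof. intros Hw. rewrite <- Hw. destruct w. clear. creal. pairs; ring. Qed.

(** Half-angle formulas; the sign of the imaginary part of q is chosen to match that of p. *)
Lemma unimodular_sqrt (p : C) : Cmod2 p = 1 -> exists q : C, Cmod2 q = 1 /\ (q * q)%C = p.
Proof.
  destruct p as [c d]. intros H. creal.
  assert (Hc : -1 <= c <= 1) by nra.
  pose proof (sqrt_sqrt ((1 + c) / 2) ltac:(lra)) as E1.
  pose proof (sqrt_sqrt ((1 - c) / 2) ltac:(lra)) as E2.
  pose proof (sqrt_pos ((1 + c) / 2)). pose proof (sqrt_pos ((1 - c) / 2)).
  set (x := sqrt ((1 + c) / 2)) in *. set (y := sqrt ((1 - c) / 2)) in *.
  assert (Exy : (2 * x * y) * (2 * x * y) = d * d).
  { transitivity (4 * (x * x) * (y * y)); [ring|]. rewrite E1, E2. nra. }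
  destruct (Rle_dec 0 d).
  - exists (x, y). simpl. split; [lra|]. f_equal; [lra|].
    assert (0 <= x * y) by nra. nra.
  - exists (x, - y). simpl. split; [lra|]. f_equal; [lra|].
    assert (0 <= x * y) by nra. nra.
Qed.

(** A form without square roots, to which both [inK0] and [inK0'] are reduced; |s| <= 2 is contained
    in the last equation. *)
Definition K0eq (x : C3) : Prop := let '(a, s, p) := x in
  Cmod2 p = 1 /\ s = (Cconj s * p)%C /\ Cmod2 a + / 4 * Cmod2 s = 1.

(* Take x = s/2 + i w q with q^2 = p and w real: since s = conj s p, the two summands are
   orthogonal, and the second one cancels in x + p conj x. *)
Lemma half_sum (s p : C) (m : R) : Cmod2 p = 1 -> s = (Cconj s * p)%C ->
  / 4 * Cmod2 s <= m -> exists x : C, Cmod2 x = m /\ (x + p * Cconj x)%C = s.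
Proof.
  intros Hp Hs Hm. destruct (unimodular_sqrt p Hp) as [q [Hq Hqq]].
  pose proof (sqrt_sqrt (m - / 4 * Cmod2 s) ltac:(lra)) as Hw.
  set (w := sqrt (m - / 4 * Cmod2 s)) in *.
  exists (s / 2 + Ci * (w * q))%C.
  assert (Hre : (s * Cconj q = Cconj s * q)%C).
  { rewrite Hs at 1. rewrite <- Hqq.
    transitivity (Cconj s * q * (q * Cconj q))%C; [ring|].
    replace (q * Cconj q)%C with (RtoC (Cmod2 q)).
    - rewrite Hq. ring.
    - destruct q. creal. f_equal; ring. }
  split.
  - destruct s as [s1 s2], q as [q1 q2]. injection Hre as _ Him.
    unfold Ci, Cdiv, Cinv. creal.
    transitivity (/ 4 * (s1 * s1 + s2 * s2) + w * w * (q1 * q1 + q2 * q2)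
      + w * (s2 * q1 - s1 * q2)); [field|].
    rewrite Hq, Hw. replace (s2 * q1 - s1 * q2) with 0 by lra. ring.
  - assert (E : (Cconj (s / 2 + Ci * (w * q)) = Cconj s / 2 - Ci * (w * Cconj q))%C).
    { destruct s, q. unfold Ci, Cdiv, Cinv. creal. f_equal; field. }
    rewrite E.
    transitivity (s / 2 + (Cconj s * p) / 2 + Ci * w * (q - p * Cconj q))%C; [field|].
    rewrite <- Hs. replace (p * Cconj q)%C with q.
    + field.
    + rewrite <- Hqq. transitivity (q * RtoC (Cmod2 q))%C; [rewrite Hq; ring|].
      destruct q. creal. f_equal; ring.
Qed.

(** The rows (x, - p conj a) and (a, p conj x) form a unitary matrix of determinant p once |x|^2 = 1
    - |a|^2; [half_sum] finds such an x with trace s. The witness is r times this matrix. *)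
Lemma dilation_inP (a s p : C) (r : R) : 0 <= r < 1 -> Cmod2 p = 1 -> s = (Cconj s * p)%C ->
  Cmod2 a + / 4 * Cmod2 s <= 1 -> inP ((r * a)%C, (r * s)%C, (r * r * p)%C).
Proof.
  intros Hr Hp Hs Ha.
  destruct (half_sum s p (1 - Cmod2 a) Hp Hs) as [x [Hx Hxs]]; [lra|].
  set (A := mkM2 (r * x)%C (r * - (p * Cconj a))%C (r * a)%C (r * (p * Cconj x))%C).
  replace ((r * a)%C, (r * s)%C, (r * r * p)%C) with (piM A).
  - apply (norm_le_inP r); [exact Hr|]. intros v.
    assert (E : C2norm2 (M2app A v) = r * r * ((Cmod2 x + Cmod2 a) *
        (Cmod2 (fst v) + Cmod2 p * Cmod2 (snd v)))).
    { unfold A. destruct x, p, a, v as [[] []]. clear. creal. ring. }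
    rewrite E, Hx, Hp. unfold C2norm2. right. ring.
  - assert (E : Cdet A = (r * r * p * RtoC (Cmod2 x + Cmod2 a))%C).
    { unfold A. destruct x, p, a. clear. creal. f_equal; ring. }
    unfold piM. rewrite E, <- Hxs, Hx.
    replace (1 - Cmod2 a + Cmod2 a) with 1 by ring.
    unfold A, Ctr. simpl. change Cadd with Cplus. change Defs.C with C.
    pairs; ring.
Qed.

(** * Analytic discs in P and the bound from a neighbourhood of K_0 *)

Lemma Cmod_Defs (z : C) : Defs.Cmod z = Cmod z.
Proof. unfold Defs.Cmod, Cmod2, Cmod. f_equal. ring. Qed.

Lemma Cmod2_sqr (z : C) : Cmod2 z = Cmod z * Cmod z.
Proof. rewrite Cmod_sqr. reflexivity. Qed.

Lemma Cmod2_mult (z w : C) : Cmod2 (z * w)%C = Cmod2 z * Cmod2 w.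
Proof. rewrite !Cmod2_sqr, Cmod_mult. ring. Qed.

Lemma Cmod2_ge_0 (z : C) : 0 <= Cmod2 z.
Proof. unfold Cmod2. nra. Qed.

Lemma Cmod2_R (x : R) : Cmod2 (RtoC x) = x * x.
Proof. unfold Cmod2. simpl. ring. Qed.

Lemma cdiff_affine_disc (f : C3 -> C) (a0 a1 s0 s1 p0 p1 z : C) :
  holomorphic_on_P f ->
  (forall w, Cmod w < 1 -> inP ((a0 + a1 * w)%C, (s0 + s1 * w)%C, (p0 + p1 * w)%C)) ->
  Cmod z < 1 ->
  cdiff (fun w => f ((a0 + a1 * w)%C, (s0 + s1 * w)%C, (p0 + p1 * w)%C)) z.
Proof.
  intros Hf HP Hz.
  destruct (Hf _ (HP z Hz)) as [l1 [l2 [l3 H]]].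
  exists (l1 * a1 + l2 * s1 + l3 * p1)%C. intros eps Heps.
  set (L := sqrt (Cmod2 a1 + Cmod2 s1 + Cmod2 p1)).
  assert (HL : 0 <= L) by apply sqrt_pos.
  assert (HD : forall w, C3dist ((a0 + a1 * w)%C, (s0 + s1 * w)%C, (p0 + p1 * w)%C)
     ((a0 + a1 * z)%C, (s0 + s1 * z)%C, (p0 + p1 * z)%C) = L * Cmod (w - z)).
  { intros w. unfold C3dist, C3sub, C3norm. change Csub with Cminus.
    replace (a0 + a1 * w - (a0 + a1 * z))%C with (a1 * (w - z))%C by ring.
    replace (s0 + s1 * w - (s0 + s1 * z))%C with (s1 * (w - z))%C by ring.
    replace (p0 + p1 * w - (p0 + p1 * z))%C with (p1 * (w - z))%C by ring.
    rewrite !Cmod2_mult, (Cmod2_sqr (w - z)).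
    replace (Cmod2 a1 * (Cmod (w - z) * Cmod (w - z)) + Cmod2 s1 * (Cmod (w - z) * Cmod (w - z))
      + Cmod2 p1 * (Cmod (w - z) * Cmod (w - z))) with
      ((Cmod2 a1 + Cmod2 s1 + Cmod2 p1) * (Cmod (w - z) * Cmod (w - z))) by ring.
    rewrite sqrt_mult.
    - rewrite sqrt_square by apply Cmod_ge_0. reflexivity.
    - pose proof (Cmod2_ge_0 a1). pose proof (Cmod2_ge_0 s1). pose proof (Cmod2_ge_0 p1). lra.
    - pose proof (Cmod_ge_0 (w - z)). nra. }
  destruct (H (eps / (L + 1))) as [d [Hd HH]].
  { apply Rdiv_lt_0_compat; lra. }
  (* The first entry keeps [w] in the unit disc, since [C_differentiable_at] only speaks of points
     of P. *)
  exists (Rmin (1 - Cmod z) (d / (L + 1))). split.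
  { apply Rmin_pos; [lra|]. apply Rdiv_lt_0_compat; lra. }
  intros w Hw.
  pose proof (Rlt_le_trans _ _ _ Hw (Rmin_l _ _)) as Hw1.
  pose proof (Rlt_le_trans _ _ _ Hw (Rmin_r _ _)) as Hw2.
  pose proof (Cmod_ge_0 (w - z)) as P0.
  assert (Hwz : Cmod w < 1).
  { pose proof (Cmod_triangle (w - z) z) as T. replace (w - z + z)%C with w in T by ring. lra. }
  specialize (HH _ (HP w Hwz)). rewrite HD in HH.
  assert (K : (L + 1) * Cmod (w - z) < d).
  { replace d with ((L + 1) * (d / (L + 1))) by (field; lra).
    apply Rmult_lt_compat_l; lra. }
  specialize (HH ltac:(lra)).
  cbv beta iota zeta in HH. rewrite Cmod_Defs in HH.
  change Csub with Cminus in HH. change Cadd with Cplus in HH. change Cmul with Cmult in HH.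
  match type of HH with Cmod ?X <= _ => match goal with |- Cmod ?Y <= _ =>
    replace Y with X by ring end end.
  eapply Rle_trans; [exact HH|].
  replace (eps * Cmod (w - z)) with (eps / (L + 1) * ((L + 1) * Cmod (w - z))) by (field; lra).
  apply Rmult_le_compat_l; [|lra]. apply Rlt_le, Rdiv_lt_0_compat; lra.
Qed.

Lemma maximum_principle_affine_disc (f : C3 -> C) (a0 a1 s0 s1 p0 p1 z0 : C) (rho M : R) :
  holomorphic_on_P f -> 0 < rho < 1 ->
  (forall w, Cmod w < 1 -> inP ((a0 + a1 * w)%C, (s0 + s1 * w)%C, (p0 + p1 * w)%C)) ->
  (forall w, Cmod w = rho ->
     Cmod (f ((a0 + a1 * w)%C, (s0 + s1 * w)%C, (p0 + p1 * w)%C)) <= M) ->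
  Cmod z0 <= rho ->
  Cmod (f ((a0 + a1 * z0)%C, (s0 + s1 * z0)%C, (p0 + p1 * z0)%C)) <= M.
Proof.
  intros Hf Hrho HP HM [Hz | Hz]; [|now apply HM].
  apply (maximum_principle
    (fun w => f ((a0 + a1 * w)%C, (s0 + s1 * w)%C, (p0 + p1 * w)%C)) rho); try assumption.
  intros z Hz1. now apply cdiff_affine_disc.
Qed.

(** Each factor differs from 1 by at most 1 - r^2, and |a| <= 1, |s| <= 2, |p| = 1 give 1 + 4 + 1 <=
    9. The factor of [a] is free because the disc in that variable produces r rho instead of r. *)
Lemma dilation_dist (a s p : C) (t r : R) : K0eq (a, s, p) -> 0 <= r <= 1 ->
  r * r <= t <= 1 -> C3dist ((t * a)%C, (r * s)%C, (r * r * p)%C) (a, s, p) <= 3 * (1 - r * r).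
Proof.
  intros [Hp [_ Ha]] Hr Ht.
  unfold C3dist, C3sub, C3norm. change Csub with Cminus.
  rewrite <- (sqrt_square (3 * (1 - r * r))) by nra.
  apply sqrt_le_1_alt.
  replace (t * a - a)%C with (RtoC (t - 1) * a)%C by (rewrite RtoC_minus; ring).
  replace (r * s - s)%C with (RtoC (r - 1) * s)%C by (rewrite RtoC_minus; ring).
  replace (r * r * p - p)%C with (RtoC (r * r - 1) * p)%C
    by (rewrite RtoC_minus, RtoC_mult; ring).
  rewrite !Cmod2_mult, !Cmod2_R, Hp.
  pose proof (Cmod2_ge_0 a). pose proof (Cmod2_ge_0 s).
  assert (E1 : (t - 1) * (t - 1) <= (1 - r * r) * (1 - r * r)) by nra.
  assert (E2 : (r - 1) * (r - 1) <= (1 - r * r) * (1 - r * r)).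
  { replace ((1 - r * r) * (1 - r * r)) with ((r - 1) * (r - 1) * ((1 + r) * (1 + r))) by ring.
    rewrite <- (Rmult_1_r ((r - 1) * (r - 1))) at 1.
    apply Rmult_le_compat_l; nra. }
  assert ((t - 1) * (t - 1) * Cmod2 a <= (1 - r * r) * (1 - r * r) * 1)
    by (apply Rmult_le_compat; nra).
  assert ((r - 1) * (r - 1) * Cmod2 s <= (1 - r * r) * (1 - r * r) * 4)
    by (apply Rmult_le_compat; nra).
  pose proof (Rle_0_sqr (1 - r * r)). unfold Rsqr in *. lra.
Qed.

Section Bound.
Variables (f : C3 -> C) (M r : R).
Hypothesis Hf : holomorphic_on_P f.
Hypothesis Hr : 0 < r < 1.
Hypothesis HM : forall x c, inP x -> K0eq c -> C3dist x c <= 3 * (1 - r * r) -> Cmod (f x) <= M.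

Lemma bound_dilation (a s p : C) : Cmod2 p = 1 -> s = (Cconj s * p)%C ->
  Cmod2 a + / 4 * Cmod2 s <= 1 -> Cmod (f ((r * a)%C, (r * s)%C, (r * r * p)%C)) <= M.
Proof.
  intros Hp Hs [Ha | Ha].
  2:{ apply (HM _ (a, s, p)).
      - apply dilation_inP; try assumption; lra.
      - repeat split; assumption.
      - apply dilation_dist; [repeat split; assumption|nra|nra]. }
  pose proof (Cmod2_ge_0 a) as Pa.
  pose proof (sqrt_sqrt (1 - / 4 * Cmod2 s) ltac:(lra)) as Hk.
  assert (Pk : 0 < sqrt (1 - / 4 * Cmod2 s)) by (apply sqrt_lt_R0; lra).
  set (k := sqrt (1 - / 4 * Cmod2 s)) in *.
  assert (Hak : Cmod a < k).
  { rewrite Cmod2_sqr in Ha. pose proof (Cmod_ge_0 a). nra. }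
  assert (Hk0 : RtoC k <> 0) by (intros E; apply (f_equal fst) in E; simpl in E; lra).
  (* The disc is w -> (r k w, r s, r^2 p). The entry |a|/k puts the target parameter a/k within
     radius rho; the entry r gives r rho >= r^2, as [dilation_dist] requires. *)
  set (rho := Rmax r (Cmod a / k)).
  assert (Hrho : 0 < rho < 1).
  { unfold rho. split.
    - apply Rlt_le_trans with r; [lra|apply Rmax_l].
    - apply Rmax_lub_lt; [lra|]. apply Rlt_div_l; lra. }
  assert (Hrr : r <= rho) by apply Rmax_l.
  assert (Hrho0 : RtoC rho <> 0) by (intros E; apply (f_equal fst) in E; simpl in E; lra).
  replace ((r * a)%C, (r * s)%C, (r * r * p)%C) with
    ((0 + r * k * (a / k))%C, (r * s + 0 * (a / k))%C, (r * r * p + 0 * (a / k))%C)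
    by (pairs; field; exact Hk0).
  apply (maximum_principle_affine_disc f) with (rho := rho); try assumption.
  - intros w Hw.
    replace (0 + r * k * w)%C with (r * (k * w))%C by ring.
    replace (r * s + 0 * w)%C with (r * s)%C by ring.
    replace (r * r * p + 0 * w)%C with (r * r * p)%C by ring.
    apply dilation_inP; try assumption; [lra|].
    rewrite Cmod2_mult, Cmod2_R, Hk, (Cmod2_sqr w).
    pose proof (Cmod_ge_0 w).
    assert (Cmod w * Cmod w <= 1) by nra.
    assert (0 <= 1 - / 4 * Cmod2 s) by lra. nra.
  - intros w Hw.
    replace (0 + r * k * w)%C with ((r * rho)%R * (k * w / rho))%C
      by (rewrite RtoC_mult; field; exact Hrho0).
    replace (r * s + 0 * w)%C with (r * s)%C by ring.
    replace (r * r * p + 0 * w)%C with (r * r * p)%C by ring.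
    assert (HK : K0eq ((k * w / rho)%C, s, p)).
    { repeat split; try assumption.
      rewrite Cmod2_sqr, Cmod_div by exact Hrho0.
      rewrite Cmod_mult, !Cmod_R, Hw, !Rabs_pos_eq by lra.
      replace (k * rho / rho) with k by (field; lra). lra. }
    assert (HD : r * r <= r * rho <= 1)
      by (destruct Hr, Hrho; split; [apply Rmult_le_compat_l; lra|nra]).
    apply (HM _ _) with (2 := HK); [|apply dilation_dist; [exact HK|lra|exact HD]].
    replace ((r * rho)%R * (k * w / rho))%C with (r * (k * w))%C
      by (rewrite RtoC_mult; field; exact Hrho0).
    apply dilation_inP; try assumption; [lra|].
    rewrite Cmod2_mult, Cmod2_R, Hk, (Cmod2_sqr w), Hw.
    assert (rho * rho <= 1) by nra.
    assert (0 <= 1 - / 4 * Cmod2 s) by lra. nra.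
  - rewrite Cmod_div, Cmod_R, Rabs_pos_eq by (assumption || lra). apply Rmax_r.
Qed.

(** Dividing z1, z2 by r leaves unimodular w1, w2: then p = w1 w2 and s = conj(s) p hold by algebra,
    and [norm_le_bounds] with radius 1 supplies the inequality for a and s. *)
Lemma bound_unitary (u v : C * C) (z1 z2 : C) : C2norm2 u = 1 -> C2norm2 v = 1 ->
  Cmod z1 = r -> Cmod z2 = r -> Cmod (f (piM (svd u v z1 z2))) <= M.
Proof.
  intros Hu Hv H1 H2.
  assert (Hr0 : RtoC r <> 0) by (intros E; apply (f_equal fst) in E; simpl in E; lra).
  assert (Hw : forall z, Cmod z = r -> exists w, z = (r * w)%C /\ Cmod2 w = 1).
  { intros z Hz. exists (z / r)%C. split; [field; exact Hr0|].
    rewrite Cmod2_sqr, Cmod_div, Cmod_R, Hz, Rabs_pos_eq by (assumption || lra). field. lra. }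
  destruct (Hw z1 H1) as [w1 [-> Hw1]]. destruct (Hw z2 H2) as [w2 [-> Hw2]].
  destruct (norm_le_bounds 1 _ _ _ _ (norm_le_svd u v w1 w2 1 Hu Hv ltac:(lra) ltac:(lra))
    (piM_svd u v w1 w2 Hu Hv)) as [B _].
  rewrite piM_svd by assumption.
  set (X := (snd u * Cconj (fst v))%C) in *. set (Y := (Cconj (fst u) * snd v)%C) in *.
  set (T := svd_s u v) in *.
  replace ((r * w1 * X - r * w2 * Y)%C, (r * w1 * T + r * w2 * Cconj T)%C, (r * w1 * (r * w2))%C)
    with ((r * (w1 * X - w2 * Y))%C, (r * (w1 * T + w2 * Cconj T))%C, (r * r * (w1 * w2))%C)
    by (pairs; ring).
  apply bound_dilation.
  - rewrite Cmod2_mult, Hw1, Hw2. ring.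
  - rewrite !Cplus_conj, !Cmult_conj, Cconj_conj.
    transitivity ((Cconj w2 * w2) * (w1 * T) + (Cconj w1 * w1) * (w2 * Cconj T))%C;
      [rewrite !Cconj_mult_unit by assumption|]; ring.
  - lra.
Qed.

(* Two applications of the maximum principle push both singular values to the circle |z| = r. *)
Lemma bound_ball (A : M2) (r0 : R) : 0 <= r0 < r -> norm_le r0 A -> Cmod (f (piM A)) <= M.
Proof.
  intros Hr0 HA.
  destruct (svd_exists r0 A HA) as [u [v [c1 [c2 [Hu [Hv [H1 [H2 ->]]]]]]]].
  assert (L : forall z, Cmod2 z <= r0 * r0 -> Cmod z <= r).
  { intros z Hz. rewrite Cmod2_sqr in Hz. pose proof (Cmod_ge_0 z). nra. }
  assert (HP : forall z1 z2, Cmod z1 < 1 -> Cmod z2 < 1 -> inP (piM (svd u v z1 z2))).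
  { intros z1 z2 Hz1 Hz2. pose proof (Cmod_ge_0 z1). pose proof (Cmod_ge_0 z2).
    pose proof (Rmax_l (Cmod z1) (Cmod z2)). pose proof (Rmax_r (Cmod z1) (Cmod z2)).
    apply (norm_le_inP (Rmax (Cmod z1) (Cmod z2))).
    - split; [lra|]. now apply Rmax_lub_lt.
    - apply norm_le_svd; try assumption; rewrite Cmod2_sqr; nra. }
  assert (E1 : forall z1 z2, piM (svd u v z1 z2) =
    ((- (z2 * (Cconj (fst u) * snd v)) + snd u * Cconj (fst v) * z1)%C,
     (z2 * Cconj (svd_s u v) + svd_s u v * z1)%C, (0 + z2 * z1)%C)).
  { intros. rewrite piM_svd by assumption. unfold svd_s. destruct u, v. simpl fst. simpl snd.
    pairs; ring. }
  assert (E2 : forall z1 z2, piM (svd u v z1 z2) =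
    ((z1 * (snd u * Cconj (fst v)) + - (Cconj (fst u) * snd v) * z2)%C,
     (z1 * svd_s u v + Cconj (svd_s u v) * z2)%C, (0 + z1 * z2)%C)).
  { intros. rewrite piM_svd by assumption. unfold svd_s. destruct u, v. simpl fst. simpl snd.
    pairs; ring. }
  rewrite E1. apply (maximum_principle_affine_disc f) with (rho := r); try assumption.
  - intros w Hw. rewrite <- E1. apply HP; [exact Hw|]. specialize (L c2 H2). lra.
  - intros z1 Hz1. rewrite <- E1, E2.
    apply (maximum_principle_affine_disc f) with (rho := r); try assumption.
    + intros w Hw. rewrite <- E2. apply HP; [lra|exact Hw].
    + intros z2 Hz2. rewrite <- E2. now apply bound_unitary.
    + now apply L.
  - now apply L.
Qed.
End Bound.

Lemma bound_near_K0 (f : C3 -> C) (M d : R) : holomorphic_on_P f -> 0 < d ->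
  (forall x c, inP x -> K0eq c -> C3dist x c < d -> Cmod (f x) <= M) ->
  forall y, inP y -> Cmod (f y) <= M.
Proof.
  intros Hf Hd HM y [A [[r0 [H0 [H1 HA]]] <-]].
  (* The first entry exceeds r0; the second gives 3 (1 - r^2) <= 6 (1 - r) <= d/2. *)
  set (r := Rmax ((1 + r0) / 2) (1 - d / 12)).
  pose proof (Rmax_l ((1 + r0) / 2) (1 - d / 12)) as R1.
  pose proof (Rmax_r ((1 + r0) / 2) (1 - d / 12)) as R2.
  fold r in R1, R2.
  assert (R3 : r < 1) by (apply Rmax_lub_lt; lra).
  apply (bound_ball f M r Hf) with (r0 := r0); try lra; [|exact HA].
  intros x c Hx Hc Hxc. apply (HM x c); try assumption. nra.
Qed.

(** * Metric and compactness in C^3; the closure of P *)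

Lemma Cmod_le_sub_add (x y : C) : Cmod x <= Cmod (x - y) + Cmod y.
Proof.
  pose proof (Cmod_triangle (x - y) y) as T. now replace (x - y + y)%C with x in T by ring.
Qed.

Lemma C3dist_eq (a s p a' s' p' : Defs.C) : C3dist (a, s, p) (a', s', p') =
  sqrt (Cmod2 (a - a')%C + Cmod2 (s - s')%C + Cmod2 (p - p')%C).
Proof. reflexivity. Qed.

Lemma C3dist_sym (x y : C3) : C3dist x y = C3dist y x.
Proof.
  destruct x as [[a s] p], y as [[a' s'] p']. rewrite !C3dist_eq. f_equal.
  rewrite !Cmod2_sqr.
  rewrite <- (Cmod_opp (a - a')), <- (Cmod_opp (s - s')), <- (Cmod_opp (p - p')).
  rewrite !Copp_minus_distr. reflexivity.
Qed.

Lemma C3dist_ge_components (a s p a' s' p' : Defs.C) :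
  Cmod (a - a') <= C3dist (a, s, p) (a', s', p') /\
  Cmod (s - s') <= C3dist (a, s, p) (a', s', p') /\
  Cmod (p - p') <= C3dist (a, s, p) (a', s', p').
Proof.
  rewrite C3dist_eq.
  pose proof (Cmod2_ge_0 (a - a')). pose proof (Cmod2_ge_0 (s - s')).
  pose proof (Cmod2_ge_0 (p - p')).
  repeat split;
    match goal with |- Cmod ?z <= _ => rewrite <- (sqrt_square (Cmod z)) by apply Cmod_ge_0;
      rewrite <- (Cmod2_sqr z) end; apply sqrt_le_1_alt; lra.
Qed.

Lemma C3dist_le_components (a s p a' s' p' : Defs.C) :
  C3dist (a, s, p) (a', s', p') <= Cmod (a - a') + Cmod (s - s') + Cmod (p - p').
Proof.
  rewrite C3dist_eq, !Cmod2_sqr.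
  pose proof (Cmod_ge_0 (a - a')). pose proof (Cmod_ge_0 (s - s')).
  pose proof (Cmod_ge_0 (p - p')).
  rewrite <- (sqrt_square (Cmod (a - a') + Cmod (s - s') + Cmod (p - p'))) by lra.
  apply sqrt_le_1_alt. nra.
Qed.

(** The constant 3 comes from comparison with the sum of the moduli; it is absorbed in the later
    choice of radii. *)
Lemma C3dist_quasi_triangle (x y z : C3) :
  C3dist x z <= 3 * (C3dist x y + C3dist y z).
Proof.
  destruct x as [[a s] p], y as [[a' s'] p'], z as [[a'' s''] p''].
  eapply Rle_trans; [apply C3dist_le_components|].
  pose proof (C3dist_ge_components a s p a' s' p') as [H1 [H2 H3]].
  pose proof (C3dist_ge_components a' s' p' a'' s'' p'') as [H4 [H5 H6]].
  pose proof (Cmod_triangle (a - a') (a' - a'')) as T1.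
  pose proof (Cmod_triangle (s - s') (s' - s'')) as T2.
  pose proof (Cmod_triangle (p - p') (p' - p'')) as T3.
  replace (a - a' + (a' - a''))%C with (a - a'')%C in T1 by ring.
  replace (s - s' + (s' - s''))%C with (s - s'')%C in T2 by ring.
  replace (p - p' + (p' - p''))%C with (p - p'')%C in T3 by ring.
  lra.
Qed.

(** Compactness of a box in R^6, in gauge form: one d lies below the gauge at some nearby centre of
    every point. Dividing the gauge by 6 turns closeness in each real coordinate into closeness in
    [C3dist]. *)
Lemma C3_compactness (b : R) (delta : C3 -> R) : (forall t, 0 < delta t) ->
  exists d, 0 < d /\ forall a s p : Defs.C, Cmod a <= b -> Cmod s <= b -> Cmod p <= b ->
    exists t, C3dist (a, s, p) t < delta t /\ d <= delta t.
Proof.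
  intros Hdelta.
  pose (pt := fun x : Compactness.Tn 6 R => let '(x1, (x2, (x3, (x4, (x5, (x6, _)))))) := x in
    ((x1, x2), (x3, x4), (x5, x6)) : C3).
  assert (H6 : forall x, 0 < delta (pt x) / 6) by (intros x; specialize (Hdelta (pt x)); lra).
  destruct (Compactness.compactness_value 6 (- b, (- b, (- b, (- b, (- b, (- b, tt))))))
    (b, (b, (b, (b, (b, (b, tt)))))) (fun x => mkposreal _ (H6 x))) as [[d Hd] H].
  exists d; split; [exact Hd|].
  intros [a1 a2] [s1 s2] [p1 p2] Ha Hs Hp.
  pose proof (fst_le_Cmod (a1, a2)) as A1. pose proof (snd_le_Cmod (a1, a2)) as A2.
  pose proof (fst_le_Cmod (s1, s2)) as A3. pose proof (snd_le_Cmod (s1, s2)) as A4.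
  pose proof (fst_le_Cmod (p1, p2)) as A5. pose proof (snd_le_Cmod (p1, p2)) as A6.
  simpl in A1, A2, A3, A4, A5, A6.
  assert (B : forall y, Rabs y <= b -> - b <= y <= b) by (intros; now apply Rabs_le_between).
  pose proof (B a1 ltac:(lra)). pose proof (B a2 ltac:(lra)). pose proof (B s1 ltac:(lra)).
  pose proof (B s2 ltac:(lra)). pose proof (B p1 ltac:(lra)). pose proof (B p2 ltac:(lra)).
  apply NNPP. intros Hn.
  apply (H (a1, (a2, (s1, (s2, (p1, (p2, tt)))))) ltac:(simpl; repeat split; lra)).
  intros [[t1 [t2 [t3 [t4 [t5 [t6 []]]]]]] [_ [Hc Hdt]]]. apply Hn.
  exists ((t1, t2), (t3, t4), (t5, t6)). simpl in Hc, Hdt.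
  split; [|lra].
  eapply Rle_lt_trans; [apply C3dist_le_components|].
  pose proof (Cmod_le_abs (a1 - t1) (a2 - t2)).
  pose proof (Cmod_le_abs (s1 - t3) (s2 - t4)).
  pose proof (Cmod_le_abs (p1 - t5) (p2 - t6)).
  change ((a1, a2) - (t1, t2))%C with (a1 - t1, a2 - t2).
  change ((s1, s2) - (t3, t4))%C with (s1 - t3, s2 - t4).
  change ((p1, p2) - (t5, t6))%C with (p1 - t5, p2 - t6).
  lra.
Qed.

Lemma inP_inPbar (x : C3) : inP x -> inPbar x.
Proof.
  intros Hx eps Heps. exists x; split; [exact Hx|].
  destruct x as [[a s] p]. eapply Rle_lt_trans; [apply C3dist_le_components|].
  replace (a - a)%C with (RtoC 0) by ring. replace (s - s)%C with (RtoC 0) by ring.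
  replace (p - p)%C with (RtoC 0) by ring. rewrite Cmod_0. lra.
Qed.

Lemma K0eq_inPbar (x : C3) : K0eq x -> inPbar x.
Proof.
  destruct x as [[a s] p]. intros Hx eps Heps.
  set (r := Rmax (1 / 2) (1 - eps / 12)).
  pose proof (Rmax_l (1 / 2) (1 - eps / 12)) as R1.
  pose proof (Rmax_r (1 / 2) (1 - eps / 12)) as R2. fold r in R1, R2.
  assert (R3 : r < 1) by (apply Rmax_lub_lt; lra).
  exists ((r * a)%C, (r * s)%C, (r * r * p)%C). split.
  - destruct Hx as [Hp [Hs Ha]]. apply dilation_inP; try assumption; lra.
  - rewrite C3dist_sym. eapply Rle_lt_trans; [apply dilation_dist; [exact Hx|lra|nra]|]. nra.
Qed.

(** Young's inequality 2 A D <= e A^2 + D^2 / e, which keeps the coefficient of the main term close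
    to 1. *)
Lemma Cmod2_perturb (z w : C) (e : R) : 0 < e ->
  Cmod2 z <= (1 + e) * Cmod2 w + (1 + / e) * Cmod2 (z - w)%C.
Proof.
  intros He. rewrite !Cmod2_sqr.
  pose proof (Cmod_triangle w (z - w)) as T. replace (w + (z - w))%C with z in T by ring.
  pose proof (Cmod_ge_0 z). pose proof (Cmod_ge_0 w). pose proof (Cmod_ge_0 (z - w)).
  set (A := Cmod w) in *. set (D := Cmod (z - w)) in *.
  apply Rle_trans with ((A + D) * (A + D)); [nra|].
  assert (0 <= (e * A - D) * (e * A - D) * / e).
  { apply Rmult_le_pos; [apply Rle_0_sqr|]. apply Rlt_le. now apply Rinv_0_lt_compat. }
  replace ((1 + e) * (A * A) + (1 + / e) * (D * D)) with
    ((A + D) * (A + D) + (e * A - D) * (e * A - D) * / e) by (field; lra). lra.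
Qed.

Lemma norm_perturb (a s p a' s' p' : Defs.C) (e : R) : 0 < e ->
  C3dist (a, s, p) (a', s', p') < e ->
  Cmod2 a + / 4 * Cmod2 s <= (1 + e) * (Cmod2 a' + / 4 * Cmod2 s') + e * (1 + e).
Proof.
  intros He H. rewrite C3dist_eq in H.
  pose proof (Cmod2_ge_0 (a - a')). pose proof (Cmod2_ge_0 (s - s')).
  pose proof (Cmod2_ge_0 (p - p')).
  assert (B1 : Cmod2 (a - a')%C + / 4 * Cmod2 (s - s')%C <= e * e).
  { apply Rle_trans with (Cmod2 (a - a')%C + Cmod2 (s - s')%C + Cmod2 (p - p')%C); [lra|].
    rewrite <- (sqrt_sqrt (Cmod2 (a - a')%C + _ + _)) by lra.
    pose proof (sqrt_pos (Cmod2 (a - a')%C + Cmod2 (s - s')%C + Cmod2 (p - p')%C)). nra. }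
  pose proof (Cmod2_perturb a a' e He). pose proof (Cmod2_perturb s s' e He).
  assert (B2 : (1 + / e) * (Cmod2 (a - a')%C + / 4 * Cmod2 (s - s')%C) <= (1 + / e) * (e * e)).
  { apply Rmult_le_compat_l; [|exact B1]. pose proof (Rinv_0_lt_compat e He). lra. }
  replace ((1 + / e) * (e * e)) with (e * (1 + e)) in B2 by (field; lra).
  lra.
Qed.

Lemma inPbar_bounds (a s p : Defs.C) : inPbar (a, s, p) ->
  Cmod2 a + / 4 * Cmod2 s <= 1 /\ Cmod p <= 1.
Proof.
  intros H.
  assert (HP : forall e, 0 < e -> exists a' s' p', C3dist (a, s, p) (a', s', p') < e /\
     Cmod2 a' + / 4 * Cmod2 s' <= 1 /\ Cmod p' <= 1).
  { intros e He. destruct (H e He) as [y [[A [[r [H0 [H1 HA]]] <-]] Hy]].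
    exists (m21 A), (Ctr A), (Cdet A). split; [exact Hy|].
    destruct (norm_le_bounds r A _ _ _ HA eq_refl) as [B1 B2].
    assert (r * r <= 1) by nra. split; [lra|].
    rewrite Cmod2_sqr in B2. pose proof (Cmod_ge_0 (Cdet A)). nra. }
  split; apply le_epsilon; intros e He.
  - destruct (HP (Rmin 1 (e / 3))) as [a' [s' [p' [H1 [H2 _]]]]]; [apply Rmin_pos; lra|].
    assert (H0 : 0 < Rmin 1 (e / 3)) by (apply Rmin_pos; lra).
    pose proof (norm_perturb _ _ _ _ _ _ _ H0 H1).
    pose proof (Rmin_l 1 (e / 3)). pose proof (Rmin_r 1 (e / 3)). nra.
  - destruct (HP e He) as [a' [s' [p' [H1 [_ H2]]]]].
    destruct (C3dist_ge_components a s p a' s' p') as [_ [_ H3]].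
    pose proof (Cmod_le_sub_add p p'). lra.
Qed.

Lemma K0eq_closed : Defs.closed_set K0eq.
Proof.
  intros [[a s] p] H.
  assert (Hp : Cmod p = 1).
  { apply Rle_antisym; apply le_epsilon; intros e He;
      destruct (H e He) as [[[a' s'] p'] [[Hp' _] Hd]];
      destruct (C3dist_ge_components a s p a' s' p') as [_ [_ H3]];
      assert (Cmod p' = 1) by (rewrite Cmod2_sqr in Hp'; pose proof (Cmod_ge_0 p'); nra).
    - pose proof (Cmod_le_sub_add p p'). lra.
    - pose proof (Cmod_le_sub_add p' p) as T. rewrite <- (Cmod_opp (p' - p)), Copp_minus_distr in T.
      lra. }
  repeat split.
  - rewrite Cmod2_sqr, Hp. ring.
  - assert (E : Cmod (s - Cconj s * p) = 0).
    { apply Rle_antisym; [|apply Cmod_ge_0]. apply le_epsilon. intros e He.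
      (* The defect of s = conj(s) p is at most |s - s'| + 2 |p - p'| + |s - s'|, hence four
         quarters. *)
      destruct (H (e / 4) ltac:(lra)) as [[[a' s'] p'] [[Hp' [Hs' Ha']] Hd]].
      destruct (C3dist_ge_components a s p a' s' p') as [_ [H2 H3]].
      assert (Hs2 : Cmod s' <= 2).
      { rewrite !Cmod2_sqr in Ha'. pose proof (Cmod_ge_0 s'). pose proof (Cmod_ge_0 a'). nra. }
      replace (s - Cconj s * p)%C with
        ((s - s') + (- (Cconj s' * (p - p')) + - (Cconj (s - s') * p)))%C.
      2:{ rewrite Cminus_conj. rewrite Hs' at 1. ring. }
      eapply Rle_trans; [apply Cmod_triangle|].
      pose proof (Cmod_triangle (- (Cconj s' * (p - p'))) (- (Cconj (s - s') * p))) as T.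
      rewrite !Cmod_opp, !Cmod_mult, !Cmod_conj, Hp in T.
      pose proof (Cmod_ge_0 (p - p')). pose proof (Cmod_ge_0 s').
      assert (Cmod s' * Cmod (p - p') <= 2 * Cmod (p - p')) by nra.
      lra. }
    apply Cmod_eq_0 in E. rewrite <- (Cplus_0_l (Cconj s * p)), <- E. cring.
  - pose proof (Cmod2_ge_0 a). pose proof (Cmod2_ge_0 s).
    set (N := Cmod2 a + / 4 * Cmod2 s).
    (* [norm_perturb] is used in both directions between the limit and a nearby point of K_0, where
       the quantity is 1. *)
    assert (HN : forall e, 0 < e < 1 -> N <= 1 + 3 * e /\ 1 <= (1 + e) * N + 2 * e).
    { intros e He. destruct (H e (proj1 He)) as [[[a' s'] p'] [[Hp' [Hs' Ha']] Hd]].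
      pose proof (norm_perturb _ _ _ _ _ _ _ (proj1 He) Hd) as P1.
      rewrite C3dist_sym in Hd.
      pose proof (norm_perturb _ _ _ _ _ _ _ (proj1 He) Hd) as P2.
      fold N in P1, P2. rewrite Ha' in P1, P2. nra. }
    assert (N <= 4) by (destruct (HN (1 / 2) ltac:(lra)); lra).
    apply Rle_antisym; apply le_epsilon; intros e He;
      destruct (HN (Rmin (1 / 2) (e / 6))) as [P1 P2];
      pose proof (Rmin_l (1 / 2) (e / 6)); pose proof (Rmin_r (1 / 2) (e / 6));
      try (split; [apply Rmin_pos; lra|lra]); assert (0 < Rmin (1 / 2) (e / 6)) by (apply Rmin_pos; lra); nra.
Qed.

(** * Peak functions and the closed boundary *)

Lemma in_AP_affine (c0 c1 c2 c3 : C) :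
  in_AP (fun x => let '(a, s, p) := x in (c0 + c1 * a + c2 * s + c3 * p)%C).
Proof.
  set (L := Cmod c1 + Cmod c2 + Cmod c3).
  assert (P1 := Cmod_ge_0 c1). assert (P2 := Cmod_ge_0 c2). assert (P3 := Cmod_ge_0 c3).
  split.
  - intros [[a s] p] _ eps Heps. exists (eps / (L + 1)).
    assert (0 < L + 1) by (unfold L; lra).
    split; [apply Rdiv_lt_0_compat; lra|].
    intros [[a' s'] p'] _ Hd. rewrite Cmod_Defs. change Csub with Cminus.
    destruct (C3dist_ge_components a' s' p' a s p) as [H1 [H2 H3]].
    set (D := C3dist (a', s', p') (a, s, p)) in *.
    replace (c0 + c1 * a' + c2 * s' + c3 * p' - (c0 + c1 * a + c2 * s + c3 * p))%C
      with (c1 * (a' - a) + c2 * (s' - s) + c3 * (p' - p))%C by ring.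
    pose proof (Cmod_triangle (c1 * (a' - a) + c2 * (s' - s)) (c3 * (p' - p))) as T1.
    pose proof (Cmod_triangle (c1 * (a' - a)) (c2 * (s' - s))) as T2.
    rewrite Cmod_mult in T1. rewrite !Cmod_mult in T2.
    assert ((L + 1) * D < eps).
    { replace eps with ((L + 1) * (eps / (L + 1))) by (field; lra).
      apply Rmult_lt_compat_l; lra. }
    pose proof (Rmult_le_compat_l _ _ _ P1 H1).
    pose proof (Rmult_le_compat_l _ _ _ P2 H2).
    pose proof (Rmult_le_compat_l _ _ _ P3 H3).
    assert (0 <= D) by apply sqrt_pos.
    unfold L in *. lra.
  - intros [[a s] p] _. exists c1, c2, c3. intros eps Heps.
    exists 1; split; [lra|]. intros [[a' s'] p'] _ _.
    rewrite Cmod_Defs. change Csub with Cminus. change Cadd with Cplus. change Cmul with Cmult.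
    match goal with |- Cmod ?X <= _ => replace X with (RtoC 0) by ring end.
    rewrite Cmod_0. apply Rmult_le_pos; [lra|apply sqrt_pos].
Qed.

Lemma K0eq_peak (x : C3) : K0eq x -> peak_point x.
Proof.
  intros Hx. split; [now apply K0eq_inPbar|].
  destruct x as [[a0 s0] p0]. destruct Hx as [Hp [_ Ha]].
  exists (fun x => let '(a, s, p) := x in
    (RtoC (/ 3) + (/ 3)%R * Cconj a0 * a + (/ 12)%R * Cconj s0 * s + (/ 3)%R * Cconj p0 * p)%C).
  split; [apply in_AP_affine|]. split.
  - destruct a0, s0, p0. creal. pairs; [|field].
    match goal with |- ?X = 1 => transitivity (/ 3 * (1 + (r * r + r0 * r0 + / 4 * (r1 * r1 + r2 * r2)) + (r3 * r3 + r4 * r4))); [field|rewrite Ha, Hp; field] end.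
  - intros [[a s] p] Hbar Hne. destruct (inPbar_bounds _ _ _ Hbar) as [B1 B2].
    rewrite Cmod_Defs. apply Rnot_le_lt. intros Hge. apply Hne. clear Hne Hbar.
    (* An inner product of (a, s) with (a0, s0), with weights 1 and 1/4; Lagrange's identity gives
       Cauchy-Schwarz for it. *)
    set (w := (Cconj a0 * a + (/ 4)%R * (Cconj s0 * s))%C).
    set (q := (Cconj p0 * p)%C).
    assert (Hw : Cmod2 w <= 1).
    { assert (E : Cmod2 w + / 4 * Cmod2 (a0 * s - s0 * a)%C =
        (Cmod2 a0 + / 4 * Cmod2 s0) * (Cmod2 a + / 4 * Cmod2 s)).
      { unfold w. destruct a, s, a0, s0. clear. creal. field. }
      pose proof (Cmod2_ge_0 (a0 * s - s0 * a)%C). rewrite Ha in E. lra. }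
    assert (Hq : Cmod2 q <= 1).
    { unfold q. rewrite Cmod2_mult.
      assert (E : Cmod2 (Cconj p0) = 1) by (rewrite <- Hp; destruct p0; clear; creal; ring).
      rewrite E, Cmod2_sqr. pose proof (Cmod_ge_0 p). nra. }
    assert (E : (RtoC (/ 3) + (/ 3)%R * Cconj a0 * a + (/ 12)%R * Cconj s0 * s + (/ 3)%R * Cconj p0 * p
       = (/ 3)%R * (1 + w + q))%C).
    { unfold w, q. destruct a, s, p, a0, s0, p0. clear. creal. pairs; field. }
    rewrite E in Hge. clear E.
    assert (H9 : 9 <= Cmod2 (1 + w + q)%C).
    { rewrite Cmod_mult, Cmod_R, Rabs_pos_eq in Hge by lra. rewrite Cmod2_sqr. nra. }
    (* Equality holds in |1 + w + q| <= 3 only for w = q = 1. *)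
    assert (E : Cmod2 (1 + w + q)%C = 3 * (1 + Cmod2 w + Cmod2 q)
      - (Cmod2 (1 - w)%C + Cmod2 (1 - q)%C + Cmod2 (w - q)%C)).
    { clearbody w q. destruct w, q. clear. creal. ring. }
    pose proof (Cmod2_ge_0 (1 - w)). pose proof (Cmod2_ge_0 (1 - q)).
    pose proof (Cmod2_ge_0 (w - q)).
    assert (W1 : Cmod2 (1 - w)%C = 0) by lra.
    assert (Q1 : Cmod2 (1 - q)%C = 0) by lra.
    assert (Z : forall z, Cmod2 (1 - z)%C = 0 -> z = 1).
    { intros [z1 z2] Hz. clear - Hz. creal. assert (z1 = 1) by nra. assert (z2 = 0) by nra.
      now subst. }
    apply Z in W1. apply Z in Q1.
    assert (Ep : p = p0).
    { transitivity (p0 * q)%C; [|rewrite Q1; cring].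
      unfold q. transitivity (RtoC (Cmod2 p0) * p)%C; [rewrite Hp; cring|].
      destruct p, p0. clear. creal. pairs; ring. }
    (* The equality case of Cauchy-Schwarz: for w = 1 the weighted squared distance is at most 1 + 1
       - 2 = 0. *)
    assert (Ew : Cmod2 (a - a0)%C + / 4 * Cmod2 (s - s0)%C =
      (Cmod2 a + / 4 * Cmod2 s) + (Cmod2 a0 + / 4 * Cmod2 s0) - 2 * fst w).
    { unfold w. destruct a, s, a0, s0. clear. creal. field. }
    replace (fst w) with 1 in Ew by (rewrite W1; reflexivity).
    pose proof (Cmod2_ge_0 (a - a0)). pose proof (Cmod2_ge_0 (s - s0)).
    assert (Z2 : forall y z, Cmod2 (y - z)%C = 0 -> y = z).
    { intros [y1 y2] [z1 z2] Hz. clear - Hz. creal.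
      destruct (Rplus_sqr_eq_0 _ _ Hz) as [E1 E2].
      f_equal; lra. }
    rewrite (Z2 a a0) by lra. rewrite (Z2 s s0) by lra. now rewrite Ep.
Qed.

Lemma peak_in_closed_boundary (S : C3 -> Prop) (x : C3) :
  peak_point x -> closed_boundary S -> S x.
Proof.
  intros [Hx [g [Hg [Hgx Hlt]]]] [_ [HSP HS]].
  destruct (HS g Hg) as [c [Hc Hmax]].
  destruct (classic (c = x)) as [-> | Hn]; [exact Hc|].
  specialize (Hlt c (HSP c Hc) Hn). specialize (Hmax x Hx).
  rewrite Hgx, !Cmod_Defs in Hmax. rewrite Cmod_Defs in Hlt.
  change (1, 0) with (RtoC 1) in Hmax. rewrite Cmod_1 in Hmax. lra.
Qed.

Lemma K0eq_bounded (a s p : C) : K0eq (a, s, p) -> Cmod a <= 2 /\ Cmod s <= 2 /\ Cmod p <= 2.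
Proof.
  intros [Hp [_ Ha]]. rewrite !Cmod2_sqr in *.
  pose proof (Cmod_ge_0 a). pose proof (Cmod_ge_0 s). pose proof (Cmod_ge_0 p).
  pose proof (Rle_0_sqr (Cmod a)). pose proof (Rle_0_sqr (Cmod s)). unfold Rsqr in *.
  repeat split; nra.
Qed.

Lemma maximum_on_K0 (f : C3 -> C) : in_AP f ->
  exists c, K0eq c /\ forall y, inPbar y -> Defs.Cmod (f y) <= Defs.Cmod (f c).
Proof.
  intros [Hcont Hhol]. apply NNPP. intros Hn.
  assert (Hbig : forall c, K0eq c -> exists y, inPbar y /\ Cmod (f c) < Cmod (f y)).
  { intros c Hc. apply NNPP. intros Hn2. apply Hn. exists c; split; [exact Hc|].
    intros y Hy. rewrite !Cmod_Defs. apply Rnot_lt_le. intros Hlt. apply Hn2. eauto. }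
  (* An increasing function of |f| with values below 1, so its supremum over the closure exists; it
     is also 1-Lipschitz in |f|. *)
  set (h := fun x => Cmod (f x) / (1 + Cmod (f x))).
  assert (Hf0 : forall x, 0 <= Cmod (f x)) by (intros; apply Cmod_ge_0).
  assert (Hh1 : forall x, h x = 1 - / (1 + Cmod (f x))).
  { intros x. unfold h. specialize (Hf0 x). field. lra. }
  assert (Hmono : forall x y, Cmod (f x) < Cmod (f y) -> h x < h y).
  { intros x y Hxy. rewrite !Hh1. pose proof (Hf0 x). pose proof (Hf0 y).
    assert (/ (1 + Cmod (f y)) < / (1 + Cmod (f x))) by (apply Rinv_lt_contravar; nra). lra. }
  assert (Hlip : forall x y e, 0 < e -> Cmod (f x) < Cmod (f y) + e -> h x < h y + e).
  { intros x y e He Hxy. rewrite !Hh1. pose proof (Hf0 x). pose proof (Hf0 y).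
    set (u := Cmod (f x)) in *. set (v := Cmod (f y)) in *.
    destruct (Rle_lt_dec u v) as [Huv | Huv].
    - assert (/ (1 + v) <= / (1 + u)) by (apply Rinv_le_contravar; lra). lra.
    - assert (E : / (1 + v) - / (1 + u) = (u - v) * / ((1 + u) * (1 + v))) by (field; lra).
      assert (/ ((1 + u) * (1 + v)) <= 1) by (rewrite <- Rinv_1; apply Rinv_le_contravar; nra).
      nra. }
  destruct (completeness (fun z => exists y, inPbar y /\ z = h y)) as [S [HS1 HS2]].
  { exists 1. intros z [y [_ ->]]. rewrite Hh1. pose proof (Hf0 y).
    pose proof (Rinv_0_lt_compat (1 + Cmod (f y)) ltac:(lra)). lra. }
  { exists (h (RtoC 1, RtoC 0, RtoC 1)), (RtoC 1, RtoC 0, RtoC 1). split; [|reflexivity].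
    apply K0eq_inPbar. clear. unfold K0eq. creal. repeat split; try field. pairs; ring. }
  assert (HS : forall y, inPbar y -> h y <= S) by (intros y Hy; apply HS1; eauto).
  assert (HSle : S <= 1).
  { apply HS2. intros z [y [_ ->]]. rewrite Hh1. pose proof (Hf0 y).
    pose proof (Rinv_0_lt_compat (1 + Cmod (f y)) ltac:(lra)). lra. }
  (* Around a point of K_0 the gauge records a gap below the supremum; off K_0 it keeps away from
     the closed set K_0, so centres near K_0 lie in it. The 6 covers 3 (d + dl) with d <= dl, from
     [C3dist_quasi_triangle]. *)
  destruct (functional_choice (fun t dl => 0 < dl /\
     (K0eq t -> forall x, inPbar x -> C3dist x t < 6 * dl -> h x <= S - dl) /\
     (~ K0eq t -> forall c, C3dist c t < dl -> ~ K0eq c))) as [delta Hdelta].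
  { intros t. destruct (classic (K0eq t)) as [Ht | Ht].
    - destruct (Hbig t Ht) as [y [Hy Hlt]]. apply Hmono in Hlt. specialize (HS y Hy).
      set (e := (S - h t) / 2). assert (He : 0 < e) by (unfold e; lra).
      destruct (Hcont t (K0eq_inPbar t Ht) e He) as [d [Hd Hc]].
      exists (Rmin e (d / 6)). split; [apply Rmin_pos; lra|]. split; [|tauto].
      intros _ x Hx Hxt.
      pose proof (Rmin_l e (d / 6)). pose proof (Rmin_r e (d / 6)).
      specialize (Hc x Hx ltac:(lra)). rewrite Cmod_Defs in Hc. change Csub with Cminus in Hc.
      assert (h x < h t + e).
      { apply Hlip; [exact He|].
        pose proof (Cmod_le_sub_add (f x) (f t)). lra. }
      unfold e in *. lra.
    - destruct (classic (exists e, 0 < e /\ forall c, C3dist c t < e -> ~ K0eq c)) as [[e [He H]] | Hno].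
      + exists e. split; [exact He|]. tauto.
      + exfalso. apply Ht. apply K0eq_closed. intros e He. apply NNPP. intros Hn3.
        apply Hno. exists e; split; [exact He|]. intros c Hc HK. apply Hn3.
        exists c. split; [exact HK|]. now rewrite C3dist_sym. }
  destruct (C3_compactness 2 delta) as [d [Hd Hcov]]; [apply Hdelta|].
  (* Near K_0 the gauge gives h <= m, and m < 1 lets this be inverted to |f| <= m / (1 - m). The
     bound spreads to P and by continuity to its closure, against the choice of [S] as a least upper
     bound. *)
  set (m := S - d).
  assert (Hm : m < 1) by (unfold m; lra).
  assert (Hconv : forall x, h x <= m <-> Cmod (f x) <= m / (1 - m)).
  { intros x. unfold h. pose proof (Hf0 x).
    rewrite Rle_div_l by lra. rewrite <- Rle_div_r by lra. lra. }
  assert (HP : forall y, inP y -> Cmod (f y) <= m / (1 - m)).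
  { apply (bound_near_K0 f _ d Hhol Hd).
    intros x [[a s] p] Hx Hc Hxc. apply Hconv.
    destruct (Hcov a s p) as [t [Ht1 Ht2]].
    1-3: now apply (K0eq_bounded a s p).
    destruct (Hdelta t) as [D1 [D2 D3]].
    assert (Kt : K0eq t).
    { apply NNPP. intros Hnt. exact (D3 Hnt _ Ht1 Hc). }
    specialize (D2 Kt x (inP_inPbar x Hx)).
    pose proof (C3dist_quasi_triangle x (a, s, p) t).
    unfold m. specialize (D2 ltac:(lra)). lra. }
  assert (HPbar : forall y, inPbar y -> h y <= m).
  { intros y Hy. apply Hconv. apply le_epsilon. intros e He.
    destruct (Hcont y Hy e He) as [dy [Hdy Hc]].
    destruct (Hy dy Hdy) as [x [Hx Hxy]]. rewrite C3dist_sym in Hxy.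
    specialize (Hc x (inP_inPbar x Hx) Hxy). specialize (HP x Hx).
    rewrite Cmod_Defs in Hc. change Csub with Cminus in Hc.
    rewrite <- Cmod_opp, Copp_minus_distr in Hc.
    pose proof (Cmod_le_sub_add (f y) (f x)). lra. }
  assert (S <= m).
  { apply HS2. intros z [y [Hy ->]]. now apply HPbar. }
  unfold m in *. lra.
Qed.

Lemma K0eq_closed_boundary : closed_boundary K0eq.
Proof.
  split; [apply K0eq_closed|split; [apply K0eq_inPbar|apply maximum_on_K0]].
Qed.

Lemma Cmod_eq_sqrt (a : C) (m : R) : 0 <= m -> Cmod a = sqrt m <-> Cmod2 a = m.
Proof.
  intros Hm. rewrite Cmod2_sqr. split.
  - intros ->. now apply sqrt_sqrt.
  - intros <-. symmetry. apply sqrt_square. apply Cmod_ge_0.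
Qed.

Lemma inK0_iff (x : C3) : inK0 x <-> K0eq x.
Proof.
  destruct x as [[a s] p]. unfold inK0, in_bGamma, K0eq. rewrite !Cmod_Defs, <- Cmod2_sqr.
  assert (U : forall z, Cmod z = 1 <-> Cmod2 z = 1).
  { intros z. rewrite <- (Cmod_eq_sqrt z 1) by lra. now rewrite sqrt_1. }
  split.
  - intros [[z1 [z2 [H1 [H2 [-> ->]]]]] Ha]. rewrite Cmod_Defs in H1, H2.
    (* [sqrt] is 0 on negative numbers, so the radicand must be seen to be nonnegative before
       squaring. *)
    assert (Hs : / 4 * Cmod2 (z1 + z2)%C <= 1).
    { rewrite Cmod2_sqr. pose proof (Cmod_triangle z1 z2). pose proof (Cmod_ge_0 (z1 + z2)). nra. }
    change (Cadd z1 z2) with (z1 + z2)%C in *. change (Cmul z1 z2) with (z1 * z2)%C.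
    apply Cmod_eq_sqrt in Ha; [|lra].
    apply U in H1. apply U in H2.
    split; [rewrite Cmod2_mult, H1, H2; ring|]. split; [|lra].
    rewrite Cplus_conj.
    transitivity ((Cconj z2 * z2) * z1 + (Cconj z1 * z1) * z2)%C;
      [rewrite !Cconj_mult_unit by assumption|]; cring.
  - intros [Hp [Hs Ha]]. pose proof (Cmod2_ge_0 a). split.
    + destruct (half_sum s p 1 Hp Hs ltac:(lra)) as [x [Hx Hxs]].
      exists x, (p * Cconj x)%C. rewrite !Cmod_Defs.
      assert (Hx2 : Cmod x = 1) by now apply U.
      split; [exact Hx2|]. split.
      { rewrite Cmod_mult, Cmod_conj, Hx2. apply U in Hp. rewrite Hp. ring. }
      split; [now symmetry|]. change Cmul with Cmult.
      transitivity (p * RtoC (Cmod2 x))%C; [rewrite Hx; cring|].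
      destruct x, p. clear. creal. pairs; ring.
    + apply Cmod_eq_sqrt; lra.
Qed.

Lemma inK0'_iff (x : C3) : inK0' x <-> K0eq x.
Proof.
  destruct x as [[a s] p]. unfold inK0', K0eq. rewrite !Cmod_Defs, <- Cmod2_sqr.
  assert (Up : Cmod p = 1 <-> Cmod2 p = 1).
  { rewrite <- (Cmod_eq_sqrt p 1) by lra. now rewrite sqrt_1. }
  rewrite Up. pose proof (Cmod2_ge_0 a). pose proof (Cmod_ge_0 s). split.
  - intros [H1 [Hp [Hs Ha]]].
    assert (/ 4 * Cmod2 s <= 1) by (rewrite Cmod2_sqr; nra).
    apply Cmod_eq_sqrt in Ha; [|lra]. repeat split; try assumption. lra.
  - intros [Hp [Hs Ha]]. repeat split; try assumption.
    + rewrite (Cmod2_sqr s) in Ha. nra.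
    + apply Cmod_eq_sqrt; lra.
Qed.

Lemma distinguished_boundary_K0 : is_distinguished_boundary K0eq.
Proof.
  split; [apply K0eq_closed_boundary|].
  intros S HS x Hx. apply peak_in_closed_boundary; [now apply K0eq_peak|exact HS].
Qed.

Lemma distinguished_boundary_unique (S S' : C3 -> Prop) (x : C3) :
  is_distinguished_boundary S -> is_distinguished_boundary S' -> S x <-> S' x.
Proof. intros [H1 H2] [H1' H2']. split; [apply H2, H1'|apply H2', H1]. Qed.

Theorem theorem8p4 :
  (forall x : C3,
     (inK0 x <-> peak_point x) /\
     (inK0 x <-> forall S : C3 -> Prop, is_distinguished_boundary S -> S x)) /\
  (exists S : C3 -> Prop, is_distinguished_boundary S) /\
  (forall S : C3 -> Prop, is_distinguished_boundary S ->
     forall x : C3, (S x <-> inK0 x) /\ (S x <-> inK0' x)).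
Proof.

  pose proof distinguished_boundary_K0 as HB.
  split; [|split].
  - intros x. rewrite inK0_iff. split; split.
    + apply K0eq_peak.
    + intros Hx. exact (peak_in_closed_boundary _ x Hx K0eq_closed_boundary).
    + intros Hx S HS. now apply (distinguished_boundary_unique S K0eq).
    (* Membership in every distinguished boundary has content because one exists, namely [K0eq]. *)
    + intros H. exact (H K0eq HB).
  - now exists K0eq.
  - intros S HS x. rewrite inK0_iff, inK0'_iff.
    split; now apply distinguished_boundary_unique.
Qed.
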